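(* There exist absolute constants $C,c>0$ such that the following holds. For a random ReLU network $\Phi:\mathbb{R}^d\to\mathbb{R}$ with symmetric biases and with $L$ hidden layers of width $N$ (as described in the context), with $d\ge C$ and $N\ge C\cdot L^2\cdot\ln(\mathrm{e}L)$, one has $$\mathrm{Lip}_p(\Phi)\ge c\cdot d^{1-1/p}\quad\text{for all }p\in[2,\infty]$$ with probability at least $1-\exp(-c\cdot\min\{N/L^2,d\})$.
   Context: Absolute constants do not depend on any parameter ($d,N,L,p$, the bias distributions, etc.); $1/\infty=0$. ReLU network with $L$ hidden layers of width $N$ ($d,N,L\in\mathbb{N}$): $\Phi=V^{(L)}\circ\mathrm{ReLU}\circ V^{(L-1)}\circ\dots\circ\mathrm{ReLU}\circ V^{(0)}:\mathbb{R}^d\to\mathbb{R}$, where $\mathrm{ReLU}(t)=\max\{0,t\}$ acts componentwise and $V^{(\ell)}(x)=W^{(\ell)}x+b^{(\ell)}$, with weights $W^{(0)}\in\mathbb{R}^{N\times d}$, $W^{(1)},\dots,W^{(L-1)}\in\mathbb{R}^{N\times N}$, $W^{(L)}\in\mathbb{R}^{1\times N}$ and biases $b^{(0)},\dots,b^{(L-1)}\in\mathbb{R}^N$, $b^{(L)}\in\mathbb{R}$. Random network: the entries of $W^{(\ell)}$, $0\le\ell<L$, are $\mathcal{N}(0,2/N)$, those of $W^{(L)}$ are $\mathcal{N}(0,1)$, all weight entries jointly independent; the entries of the biases are drawn independently from (possibly different) real-valued distributions and are jointly independent of the weights. ''Symmetric biases'' means that every entry of every bias vector has a symmetric distribution (e.g.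 identically zero biases are allowed). Lipschitz constant: $\mathrm{Lip}_p(\Phi)=\sup_{x\ne y}|\Phi(x)-\Phi(y)|/\|x-y\|_p$. *)

(* Defs.v *)
From HB Require Import structures.
From mathcomp Require Import all_boot all_order all_algebra.
From mathcomp Require Import all_classical all_reals all_analysis.

Set Implicit Arguments.
Unset Strict Implicit.
Unset Printing Implicit Defensive.

Import Order.TTheory GRing.Theory Num.Theory.
Import numFieldNormedType.Exports.

Local Open Scope classical_set_scope.
Local Open Scope ring_scope.

(* [width d N l] is the input dimension of the affine map V^(l). *)
Definition width (d N l : nat) : nat := if l is 0%N then d else N.

(* The parameters of a network with L hidden layers of width N, with entries in
   an arbitrary type A: real numbers for a deterministic network, random
   variables for a random one. [weight f l] and [bias f l] are W^(l) and b^(l)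
   for l < L; the output layer W^(L), b^(L) is kept apart. For 0 < L the number
   [width d N L] of columns of W^(L) is N. *)
Record network (A : Type) (d N L : nat) := Network {
  weight : forall l : 'I_L, 'M[A]_(N, width d N l);
  bias : 'I_L -> 'cV[A]_N;
  out_weight : 'rV[A]_(width d N L);
  out_bias : A }.

Definition map_network (A B : Type) (h : A -> B) (d N L : nat)
    (f : network A d N L) : network B d N L :=
  Network (fun l => map_mx h (weight f l)) (fun l => map_mx h (bias f l))
          (map_mx h (out_weight f)) (h (out_bias f)).

Section relu_network.
Variables (R : realType) (d N L : nat).

Definition relu (n : nat) (x : 'cV[R]_n) : 'cV[R]_n :=
  map_mx (fun t => Num.max 0 t) x.

(* The activations after l hidden layers; [hidden f x 0] is the input x. *)
Fixpoint hidden (f : network R d N L) (x : 'cV[R]_d) (l : nat) :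
    (l <= L)%N -> 'cV[R]_(width d N l) :=
  match l return (l <= L)%N -> 'cV[R]_(width d N l) with
  | 0%N => fun _ => x
  | k.+1 => fun hk : (k < L)%N =>
      relu (weight f (Ordinal hk) *m hidden f x (ltnW hk) + bias f (Ordinal hk))
  end.

Definition net_fun (f : network R d N L) (x : 'cV[R]_d) : R :=
  (out_weight f *m hidden f x (leqnn L)) 0 0 + out_bias f.

End relu_network.

(* Only used for 1 <= p; the value at -oo is irrelevant. *)
Definition pnorm (R : realType) (p : \bar R) (d : nat) (x : 'cV[R]_d) : R :=
  match p with
  | r%:E => (\sum_(i < d) `|x i 0| `^ r) `^ r^-1
  | +oo%E => \big[Num.max/0]_(i < d) `|x i 0|
  | -oo%E => 0
  end.

Definition Lip (R : realType) (p : \bar R) (d : nat) (F : 'cV[R]_d -> R) :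
    \bar R :=
  ereal_sup [set (`|F z.1 - F z.2| / pnorm p (z.1 - z.2))%:E
            | z in [set z : 'cV[R]_d * 'cV[R]_d | z.1 != z.2]].

Section random_network.
Context {dsp : measure_display} {T : measurableType dsp} {R : realType}.
Variable P : probability T R.

Definition mutually_independent (I : finType) (X : I -> {RV P >-> R}) : Prop :=
  forall (J : {set I}) (B : I -> set R), (forall i, measurable (B i)) ->
    P (\bigcap_(i in [set` J]) X i @^-1` B i) =
    (\prod_(i in J) P (X i @^-1` B i))%E.

(* The second parameter of [normal_prob] is the standard deviation. *)
Definition centered_gaussian (variance : R) (X : {RV P >-> R}) : Prop :=
  forall A : set R, measurable A ->
    distribution P X A = normal_prob 0 (Num.sqrt variance) A.

Definition symmetric_distribution (X : {RV P >-> R}) : Prop :=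
  forall A : set R, measurable A ->
    P [set w | A (X w)] = P [set w | A (- X w)].

Section entries.
Variables d N L : nat.

(* The positions of the scalar parameters, in this order: entries of the W^(l)
   and of the b^(l) with l < L, entries of W^(L), and b^(L). *)
Definition param : finType :=
  ({l : 'I_L & ('I_N * 'I_(width d N l))%type} + ('I_L * 'I_N)
   + 'I_(width d N L) + unit)%type.

Definition entry (A : Type) (f : network A d N L) (k : param) : A :=
  match k with
  | inl (inl (inl (existT l (i, j)))) => weight f l i j
  | inl (inl (inr (l, i))) => bias f l i 0
  | inl (inr j) => out_weight f 0 j
  | inr tt => out_bias f
  end.

Definition random_network (f : network {RV P >-> R} d N L) : Prop :=
  [/\ forall l i j, centered_gaussian (2 / N%:R) (weight f l i j),
      forall j, centered_gaussian 1 (out_weight f 0 j)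
    & mutually_independent (entry f)].

Definition symmetric_biases (f : network {RV P >-> R} d N L) : Prop :=
  (forall l i, symmetric_distribution (bias f l i 0)) /\
  symmetric_distribution (out_bias f).

Definition realization (f : network {RV P >-> R} d N L) (w : T) :
    network R d N L :=
  map_network (fun X : {RV P >-> R} => X w) f.

End entries.
End random_network.

(* Main.v *)
(* Only p = oo matters: moving from x in direction t v with v in
   {-1, 1}^d gives Lip_p >= |grad|_1 / d^(1/p), where grad is the gradient of the
   affine piece of the network around x = (1, ..., 1).

   Activation patterns. For a prescribed 0-1 pattern D, replace each ReLU by the
   multiplication with D. Flipping signs of the rows and columns of the weights
   according to D and to the signs t of the preactivations of this linear network
   preserves the law of the parameters (this uses the symmetry of the biases) and
   the gradient [grad theta D], and it exchanges the events "the preactivations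
   have signs t" and "the true activation pattern is D". As almost surely no
   preactivation vanishes, summing over t shows that the true gradient has the
   law of [grad theta D] with D uniform and independent of the weights.

   Tails. With D independent of the weights the gradient is computed backwards,
   layer by layer, by independent Gaussian matrices. Given the past, each step
   multiplies the squared norm by a factor at least 1 - 1/(2 L), except with
   probability exp (- N / (48 L^2)) (Chernoff's bound for a chi-square variable,
   averaged over D); hence it stays at least N / 4, and the last step produces d
   independent Gaussians whose variance is at least 1/2. *)
Require Import Defs.
From HB Require Import structures.
From mathcomp Require Import all_boot all_order all_algebra.
From mathcomp Require Import all_classical all_reals all_analysis.
From mathcomp Require Import measurable_realfun ring lra.

Set Implicit Arguments.
Unset Strict Implicit.
Unset Printing Implicit Defensive.

Import Order.TTheory GRing.Theory Num.Theory.
Import numFieldNormedType.Exports.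

Local Open Scope classical_set_scope.
Local Open Scope ring_scope.

(** * Product laws on finitely many real coordinates *)

Section coordinate_space.
Variables (R : realType) (I : finType).

Definition rectangle (B : I -> set R) : set (I -> R) :=
  [set theta | forall k, B k (theta k)].

Definition rectangles : set (set (I -> R)) :=
  [set S | exists2 B, (forall k, measurable (B k)) & S = rectangle B].

(** A named copy of the function type, so that it can carry the product sigma-algebra, here
    generated by the rectangles. *)
Definition coords : Type := I -> R.

HB.instance Definition _ :=
  Measurable.copy coords (g_sigma_algebraType rectangles).

Definition update (theta : coords) (k : I) (s : R) : coords :=
  fun j => if j == k then s else theta j.

Lemma measurable_coord k :
  measurable_fun [set: coords] (fun theta : coords => theta k : R).
Proof.
move=> _ B mB; rewrite setTI; apply: sub_sigma_algebra.
exists (fun j => if j == k then B else setT).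
  by move=> j; case: ifP.
apply/seteqP; split=> [th /= Bth j|th /(_ k)/=]; last by rewrite eqxx.
by case: eqVneq => // ->.
Qed.

Lemma measurable_fun_coords d (T : measurableType d) (f : T -> coords) :
  (forall k, measurable_fun [set: T] (fun t => f t k)) ->
  measurable_fun [set: T] f.
Proof.
move=> mf; apply: (@measurability _ _ _ _ _ _ (rectangles : set (set coords))) => //.
move=> _ [_ [B mB ->] <-]; rewrite setTI.
have -> : f @^-1` rectangle B = \big[setI/setT]_k (fun t => f t k) @^-1` B k.
  rewrite -bigcap_seq; apply/seteqP; split=> t /= h.
    by move=> k _; exact: h.
  by move=> k; apply: h => /=; rewrite mem_index_enum.
apply: bigsetI_measurable => k _.
by rewrite -[X in measurable X]setTI; apply: mf.
Qed.

Lemma measurable_rectangle (B : I -> set R) :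
  (forall k, measurable (B k)) -> measurable (rectangle B : set coords).
Proof. by move=> mB; apply: sub_sigma_algebra; exists B. Qed.

(** The rectangles form a pi-system generating the sigma-algebra, so Dynkin's theorem applies. *)
Lemma coords_measure_unique (m1 m2 : probability coords R) :
  (forall B : I -> set R, (forall k, measurable (B k)) ->
     m1 (rectangle B) = m2 (rectangle B)) ->
  forall A, measurable A -> m1 A = m2 A.
Proof.
move=> m12; apply: (measure_unique (rectangles : set (set coords)) (fun=> setT)) => //.
- move=> _ _ [B mB ->] [C mC ->]; exists (fun k => B k `&` C k).
    by move=> k; exact: measurableI.
  apply/seteqP; split => [th [hB hC] k|th h]; first by split.
  by split => k; have [] := h k.
- by move=> _; exists (fun=> setT) => //; apply/seteqP; split.
- by apply/seteqP; split => // th _; exists 0%N.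
- by move=> _ [B mB ->]; exact: m12.
- by move=> _ /=; rewrite (@probability_setT _ _ _ m1) ltry.
Qed.

Lemma measurable_update k :
  measurable_fun [set: coords * R] (fun z => update z.1 k z.2).
Proof.
apply: measurable_fun_coords => j; rewrite /update.
case: eqVneq => _; first exact: measurable_snd.
exact: (measurableT_comp (measurable_coord j) measurable_fst).
Qed.

(** Stated by values on rectangles, which is the form that mutual independence provides directly. *)
Definition product_law (mu : probability coords R) (nu : I -> probability R R) :=
  forall B : I -> set R, (forall k, measurable (B k)) ->
    mu (rectangle B) = (\prod_k nu k (B k))%E.

Variables (mu : probability coords R) (nu : I -> probability R R).
Hypothesis mu_nu : product_law mu nu.

(** Drawing coordinate k afresh preserves a product law; Tonelli's theorem then isolates an inner
    integral over that coordinate. This takes the place of conditional expectations. *)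
Lemma integral_resample (k : I) (f : coords -> \bar R) :
  measurable_fun [set: coords] f -> (forall theta, (0 <= f theta)%E) ->
  (\int[mu]_theta f theta =
   \int[mu]_theta \int[nu k]_s f (update theta k s))%E.
Proof.
move=> mf f0.
pose g (z : coords * R) := update z.1 k z.2.
have mg : measurable_fun setT g by exact: measurable_update.
have fg : measurable_fun setT (f \o g) by exact: measurableT_comp.
have h1 := @fubini_tonelli1 _ _ _ _ _ mu (nu k) (f \o g) fg (fun z => f0 (g z)).
rewrite /fubini_F /= in h1.
rewrite -h1.
rewrite (@eq_measure_integral _ _ _ setT (pushforward (mu \x nu k)%E g)); last first.
  move=> A mA _; pose G : {mfun _ >-> coords} := mfun_Sub (mem_set mg).
  apply: (@coords_measure_unique mu (distribution (mu \x nu k)%E G)) => // B mB.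
  rewrite mu_nu// /distribution /pushforward /=.
  have -> : g @^-1` rectangle B =
      (rectangle (fun j => if j == k then setT else B j)) `*` B k.
    apply/seteqP; split=> [z /= hz|z [/= hz1 hz2] j].
      split=> /= [j|]; last by have := hz k; rewrite /g /update eqxx.
      by case: eqVneq => // jk; have := hz j; rewrite /g /update (negbTE jk).
    by have := hz1 j; rewrite /g /update; case: eqVneq => // ->.
  rewrite product_measure1E//; last first.
    by apply: measurable_rectangle => j; case: ifP.
  have mB' j : measurable (if j == k then setT else B j) by case: ifP.
  rewrite [X in (X * _)%E](mu_nu mB').
  rewrite (bigD1 k)//= muleC [in RHS](bigD1 k)//= eqxx probability_setT mul1e.
  by congr (_ * _)%E; apply: eq_bigr => j /negbTE ->.
by rewrite ge0_integral_pushforward// => y _; exact: f0.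
Qed.
End coordinate_space.

(** * Gaussian integrals *)

Section gaussian.
Context {R : realType}.
Local Notation leb := (@lebesgue_measure R).

(** The Radon-Nikodym derivative of the normal law agrees almost everywhere with [normal_pdf], since
    both have the same integral over every measurable set. *)
Lemma integral_normal_prob_density (m s : R) (f : R -> \bar R) :
  measurable_fun setT f ->
  (\int[normal_prob m s]_x `|f x| < +oo)%E ->
  (\int[normal_prob m s]_x f x = \int[leb]_x (f x * (normal_pdf m s x)%:E))%E.
Proof.
move=> mf finf.
rewrite -(Radon_Nikodym_change_of_variables (normal_prob_dominates m s))//=; last first.
  by apply/integrableP; split.
apply: ae_eq_integral => //.
- apply: emeasurable_funM => //; apply: (measurable_int leb).
  apply: (integrableS _ _ (@subsetT _ _)) => //=.
  by apply: Radon_Nikodym_integrable; exact: normal_prob_dominates.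
- apply: emeasurable_funM => //=; apply/measurableT_comp => //=.
  by apply/measurable_funTS; exact: measurable_normal_pdf.
- apply: ae_eqe_mul2l => /=.
  rewrite Radon_NikodymE//=; first exact: normal_prob_dominates.
  move=> abmu; case: cid => /= h [h1 h2 h3].
  apply: integral_ae_eq => //=.
  + by apply/measurable_funTS/measurableT_comp =>//; exact: measurable_normal_pdf.
  + by move=> E _ mE; rewrite -h3.
Qed.

Lemma normal_prob_opp (s : R) (A : set R) : s != 0 -> measurable A ->
  normal_prob 0 s [set x | A (- x)] = normal_prob 0 s A.
Proof.
move=> s0 mA; rewrite /normal_prob.
transitivity (\int[leb]_(x in (-%R : _ -> measurableTypeR R) @^-1` A)
    (((fun x => (normal_pdf 0 s x)%:E) \o -%R) x))%E.
  apply: eq_integral => x _ /=.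
  by rewrite !normal_pdfE// /normal_fun !subr0 sqrrN.
rewrite -ge0_integral_pushforward//=; last 2 first.
- by apply/measurable_EFinP/measurable_funTS; exact: measurable_normal_pdf.
- by move=> x _; rewrite lee_fin normal_pdf_ge0.
by apply: eq_measure_integral => //= B mB _; exact: lebesgue_measureN.
Qed.

(** Completing the square: the integrand times the normal density is a constant multiple of another
    normal density. The result is again the exponential of a negative multiple of a^2, so
    coordinates can be integrated out one after another. *)
Lemma integral_expR_normal (s a b c : R) : 0 < s -> 0 <= c ->
  (\int[normal_prob 0 s]_x (expR (- (c * (a + b * x) ^+ 2)))%:E =
   ((Num.sqrt (1 + 2 * c * (b * s) ^+ 2))^-1 *
     expR (- (c / (1 + 2 * c * (b * s) ^+ 2) * a ^+ 2)))%:E)%E.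
Proof.
move=> s0 c0.
have mf : measurable_fun setT (fun x : R => (expR (- (c * (a + b * x) ^+ 2)))%:E).
  apply/measurable_EFinP; apply: (measurableT_comp (@measurable_expR R)).
  apply: measurableT_comp => //; apply: measurable_funM => //.
  by apply: measurable_funX; apply: measurable_funD => //; apply: measurable_funM.
rewrite integral_normal_prob_density//; last first.
  under eq_integral do rewrite gee0_abs ?lee_fin ?expR_ge0//.
  apply: (@le_lt_trans _ _ (\int[normal_prob 0 s]_x (cst 1%E x))%E).
    apply: ge0_le_integral => //.
    move=> x _; rewrite lee_fin -[leRHS]expR0 ler_expR oppr_le0.
    by rewrite mulr_ge0// sqr_ge0.
  rewrite integral_cst// mul1e.
  by apply: (le_lt_trans (probability_le1 _ _)) => //; exact: ltry.
set q := 1 + _.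
have q0 : 0 < q by apply: ltr_pwDl => //; rewrite mulr_ge0 ?sqr_ge0// mulr_ge0.
(* [s'] and [m'] are the standard deviation and the mean that completing the square produces. *)
pose s' := s / Num.sqrt q.
have s'0 : 0 < s' by rewrite divr_gt0// sqrtr_gt0.
have s'2 : s' ^+ 2 = s ^+ 2 / q by rewrite expr_div_n sqr_sqrtr// ltW.
pose m' := - (2 * c * a * b * s ^+ 2 / q).
set K := (_ * expR _)%R.
transitivity (\int[leb]_x (K%:E * (normal_pdf m' s' x)%:E))%E.
  apply: eq_integral => x _; rewrite -!EFinM; congr (_%:E).
  rewrite !normal_pdfE ?gt_eqF//.
  have -> : normal_peak s' = Num.sqrt q * normal_peak s.
    rewrite /normal_peak s'2.
    have -> : s ^+ 2 / q * pi *+ 2 = (s ^+ 2 * pi *+ 2) / q.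
      by rewrite mulrAC mulrnAl.
    rewrite sqrtrM; last by rewrite mulrn_wge0// mulr_ge0 ?sqr_ge0 ?pi_ge0.
    by rewrite sqrtrV ?ltW// invfM invrK mulrC.
  rewrite /K /normal_fun.
  rewrite [LHS]mulrCA -expRD [RHS]mulrACA mulKf ?gt_eqF ?sqrtr_gt0//.
  rewrite -expRD; congr (_ * expR _).
  rewrite s'2 /m' subr0 -(mulr_natr (s ^+ 2)) -(mulr_natr (s ^+ 2 / q)).
  suff : q = 1 + 2 * c * (b * s) ^+ 2.
    by move=> E; move: q0; rewrite E => q0; field; rewrite !gt_eqF// -E.
  by [].
rewrite ge0_integralZl//.
- by rewrite integral_normal_pdf mule1.
- by apply/measurable_EFinP; exact: measurable_normal_pdf.
- by move=> x _; rewrite lee_fin normal_pdf_ge0.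
- by rewrite lee_fin mulr_ge0// ?expR_ge0// invr_ge0 sqrtr_ge0.
Qed.

Lemma normal_prob_set1 (s x : R) : normal_prob 0 s [set x] = 0%E.
Proof.
have /null_content_dominatesP := normal_prob_dominates (0 : R) s.
by apply; [exact: measurable_set1|exact: lebesgue_measure_set1].
Qed.

End gaussian.

Section real_measurability.
Context d (T : measurableType d) (R : realType).

Lemma measurable_fun_inv (f : T -> R) :
  (forall t, 0 < f t) -> measurable_fun [set: T] f ->
  measurable_fun [set: T] (fun t => (f t)^-1).
Proof.
move=> f0 mf.
have -> : (fun t => (f t)^-1) = (fun t => expR (- ln (f t))).
  by apply/funext => t; rewrite expRN lnK// posrE.
apply: measurableT_comp => //; apply: measurable_funN.
exact: measurableT_comp.
Qed.

Lemma measurable_fun_sqrt (f : T -> R) : measurable_fun [set: T] f ->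
  measurable_fun [set: T] (fun t => Num.sqrt (f t)).
Proof.
move=> mf; have ms : measurable_fun [set: R] (@Num.sqrt R).
  by apply: continuous_measurable_fun; exact: sqrt_continuous.
exact: measurableT_comp.
Qed.

End real_measurability.

(** * Integrating Gaussian coordinates out of a product law *)

Section gaussian_blocks.
Variables (R : realType) (I : finType).
Variables (mu : probability (coords R I) R) (nu : I -> probability R R).
Hypothesis mu_nu : product_law mu nu.

(** Under a product law this expresses that f is independent of coordinate k. *)
Definition ignores (k : I) (U : Type) (f : coords R I -> U) :=
  forall theta s, f (update theta k s) = f theta.

Definition gaussian_coord (s : R) (k : I) :=
  forall A, measurable A -> nu k A = normal_prob 0 s A.

Variable (sigma : R).
Hypothesis sigma_gt0 : 0 < sigma.

Implicit Types (h c A B : coords R I -> R).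

(* [normal_prob] lives on [measurableTypeR R], whose measurable structure is not
   convertible to the canonical one on [R], although the measurable sets are. *)
Lemma integral_gaussian_coord_law k (f : R -> \bar R) : gaussian_coord sigma k ->
  measurable_fun setT f -> (forall x, 0 <= f x)%E ->
  (\int[nu k]_x f x = \int[normal_prob 0 sigma]_x f x)%E.
Proof.
move=> gk mf f0.
have mid : @measurable_fun _ _ (measurableTypeR R) R setT (fun x => x).
  by move=> _ A mA; rewrite setTI.
pose G := @mfun_Sub _ _ (measurableTypeR R) R _ (mem_set mid).
rewrite (@eq_measure_integral _ _ _ _ (distribution (normal_prob 0 sigma) G)).
  by rewrite ge0_integral_pushforward.
by move=> A mA _; apply: gk.
Qed.

Lemma integral_gaussian_coord k h c A B : gaussian_coord sigma k ->
  ignores k h -> ignores k c -> ignores k A -> ignores k B ->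
  measurable_fun setT h -> measurable_fun setT c ->
  measurable_fun setT A -> measurable_fun setT B ->
  (forall theta, 0 <= h theta) -> (forall theta, 0 <= c theta) ->
  let q theta := 1 + 2 * c theta * (B theta * sigma) ^+ 2 in
  (\int[mu]_theta
     (h theta * expR (- (c theta * (A theta + B theta * theta k) ^+ 2)))%:E =
   \int[mu]_theta (h theta * (Num.sqrt (q theta))^-1 *
     expR (- (c theta / q theta * A theta ^+ 2)))%:E)%E.
Proof.
move=> gk ih ic iA iB mh mc mA mB h0 c0 q.
rewrite (integral_resample mu_nu k); last 2 first.
- apply/measurable_EFinP; apply: measurable_funM => //.
  apply: (measurableT_comp (@measurable_expR R)); apply: measurable_funN.
  apply: measurable_funM => //; apply: measurable_funX.
  apply: measurable_funD => //; apply: measurable_funM => //.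
  exact: measurable_coord.
- by move=> theta; rewrite lee_fin mulr_ge0// expR_ge0.
apply: eq_integral => theta _.
under eq_integral do rewrite ih ic iA iB /update eqxx EFinM.
have mg : measurable_fun [set: R] (fun s : R =>
    (expR (- (c theta * (A theta + B theta * s) ^+ 2)))%:E).
  apply/measurable_EFinP; apply: (measurableT_comp (@measurable_expR R)).
  apply: measurable_funN; apply: measurable_funM => //; apply: measurable_funX.
  by apply: measurable_funD => //; apply: measurable_funM.
have g0 s : (0 <= (expR (- (c theta * (A theta + B theta * s) ^+ 2)))%:E)%E.
  by rewrite lee_fin expR_ge0.
rewrite ge0_integralZl//; last by rewrite lee_fin.
rewrite [X in (_ * X)%E](integral_gaussian_coord_law gk mg g0).
by rewrite integral_expR_normal// -EFinM mulrA.
Qed.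

(** Given the coefficients, the sum is a centred Gaussian whose variance is sigma^2 times the sum of
    their squares. Each induction step moves one normalising factor into [h] and shrinks [c], so
    both have to be arbitrary functions. *)
Lemma integral_gaussian_linear (T : eqType) (k : T -> I) (ts : seq T) h c A
    (B : T -> coords R I -> R) :
  uniq (map k ts) -> {in ts, forall t, gaussian_coord sigma (k t)} ->
  {in ts, forall t, [/\ ignores (k t) h, ignores (k t) c, ignores (k t) A
                      & forall u, ignores (k t) (B u)]} ->
  measurable_fun setT h -> measurable_fun setT c -> measurable_fun setT A ->
  (forall j, measurable_fun setT (B j)) ->
  (forall theta, 0 <= h theta) -> (forall theta, 0 <= c theta) ->
  let q theta := 1 + 2 * c theta * (sigma ^+ 2 * \sum_(t <- ts) B t theta ^+ 2) in
  (\int[mu]_theta (h theta *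
     expR (- (c theta * (A theta + \sum_(t <- ts) B t theta * theta (k t)) ^+ 2)))%:E =
   \int[mu]_theta (h theta * (Num.sqrt (q theta))^-1 *
     expR (- (c theta / q theta * A theta ^+ 2)))%:E)%E.
Proof.
elim: ts h c => [|t ts IH] h c /=.
  move=> _ _ _ mh mc mA mB h0 c0; apply: eq_integral => theta _.
  by rewrite !big_nil !mulr0 !addr0 sqrtr1 invr1 !mulr1.
move=> /andP[kts uts] gts its mh mc mA mB h0 c0.
have [ih ic iA iB] := its t (mem_head _ _).
under eq_integral do rewrite big_cons [B t _ * _ + _]addrC addrA.
rewrite (integral_gaussian_coord (A := fun theta =>
  A theta + \sum_(u <- ts) B u theta * theta (k u))
  (gts t (mem_head _ _)) ih ic _ (iB t) mh mc _ (mB t) h0 c0); last 2 first.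
- move=> theta s; rewrite iA; congr (_ + _).
  apply: eq_big_seq => u uts'; rewrite iB /update.
  by case: eqVneq => // uk; rewrite -uk map_f in kts.
- apply: measurable_funD => //; apply: measurable_sum => j.
  by apply: measurable_funM => //; exact: measurable_coord.
pose q1 theta := 1 + 2 * c theta * (B t theta * sigma) ^+ 2.
have q10 theta : 0 < q1 theta.
  by apply: ltr_pwDl => //; rewrite mulr_ge0 ?sqr_ge0// mulr_ge0.
have mq1 : measurable_fun setT q1.
  apply: measurable_funD => //; apply: measurable_funM.
    by apply: measurable_funM.
  by apply: measurable_funX; apply: measurable_funM.
rewrite (IH (fun theta => h theta * (Num.sqrt (q1 theta))^-1)
            (fun theta => c theta / q1 theta) uts _ _ _ _ mA mB).
- apply: eq_integral => theta _; congr (_%:E).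
  rewrite big_cons; set S := \sum_(u <- ts) _.
  have S0 : 0 <= S by apply: sumr_ge0 => j _; exact: sqr_ge0.
  (* The variance factors telescope: that of the whole list is the factor of t times the factor of
     the tail for the shrunken [c]. *)
  have -> : 1 + 2 * c theta * (sigma ^+ 2 * (B t theta ^+ 2 + S)) =
      q1 theta * (1 + 2 * (c theta / q1 theta) * (sigma ^+ 2 * S)).
    transitivity (q1 theta + 2 * c theta * (sigma ^+ 2 * S)).
      by rewrite /q1; ring.
    by have /lt0r_neq0 := q10 theta; move: (q1 theta) => Q Q0; field.
  rewrite sqrtrM; last by rewrite ltW.
  by rewrite [in RHS]invfM [in RHS]mulrA invfM !mulrA.
- by move=> u uts'; apply: gts; rewrite in_cons uts' orbT.
- move=> u uts'; have [|ihj icj iAj iBj] := its u.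
    by rewrite in_cons uts' orbT.
  by split => //; rewrite /q1 => theta s; rewrite ?ihj ?icj ?iBj.
- apply: measurable_funM => //; apply: measurable_fun_inv.
    by move=> theta; rewrite sqrtr_gt0.
  exact: measurable_fun_sqrt.
- by apply: measurable_funM => //; apply: measurable_fun_inv.
- by move=> theta; rewrite mulr_ge0// invr_ge0 sqrtr_ge0.
- by move=> theta; rewrite mulr_ge0// invr_ge0 ltW.
Qed.

(** Given B, the column sums use disjoint coordinates because [k] is injective, so they are
    independent, and exp(-Y^2) has mean 1/sqrt(q). Factors affine in exp(-Y^2) cover both masked
    squares and the bound used for absolute values. *)
Lemma integral_gaussian_columns (T : finType) (J : eqType) (k : T -> J -> I)
    (js : seq J) h (B : T -> coords R I -> R) (a b : J -> R) :
  injective (fun p : T * J => k p.1 p.2) -> uniq js ->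
  {in js, forall j t, gaussian_coord sigma (k t j)} ->
  {in js, forall j t, ignores (k t j) h /\ forall u, ignores (k t j) (B u)} ->
  measurable_fun setT h -> (forall t, measurable_fun setT (B t)) ->
  (forall theta, 0 <= h theta) -> (forall j, 0 <= a j) -> (forall j, 0 <= b j) ->
  let Y theta j := \sum_t B t theta * theta (k t j) in
  let q theta := 1 + 2 * (sigma ^+ 2 * \sum_t B t theta ^+ 2) in
  (\int[mu]_theta (h theta *
     \prod_(j <- js) (a j + b j * expR (- Y theta j ^+ 2)))%:E =
   \int[mu]_theta (h theta *
     \prod_(j <- js) (a j + b j * (Num.sqrt (q theta))^-1))%:E)%E.
Proof.
move=> k_inj ujs gjs ijs mh mB h0 a0 b0 Y q.
have q0 theta : 0 < q theta.
  apply: ltr_pwDl => //; rewrite mulr_ge0// mulr_ge0 ?sqr_ge0// sumr_ge0// => t _.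
  exact: sqr_ge0.
have r0 theta : 0 <= (Num.sqrt (q theta))^-1 by rewrite invr_ge0 sqrtr_ge0.
have mr : measurable_fun setT (fun theta => (Num.sqrt (q theta))^-1).
  apply: measurable_fun_inv; first by move=> theta; rewrite sqrtr_gt0.
  apply: measurable_fun_sqrt; apply: measurable_funD => //.
  apply: measurable_funM => //; apply: measurable_funM => //.
  by apply: measurable_sum => t; apply: measurable_funX.
have mY j : measurable_fun setT (fun theta => Y theta j).
  apply: measurable_sum => t; apply: measurable_funM => //.
  exact: measurable_coord.
have mE j : measurable_fun setT (fun theta => expR (- Y theta j ^+ 2)).
  apply: (measurableT_comp (@measurable_expR R)); apply: measurable_funN.
  exact: measurable_funX.
have iq j t : j \in js -> ignores (k t j) q.
  by move=> jjs theta s; rewrite /q; under eq_bigr do rewrite (ijs j jjs t).2.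
elim: js h ujs gjs ijs mh h0 iq => [|j js IH] h /=.
  by move=> *; apply: eq_integral => theta _; rewrite !big_nil.
move=> /andP[jjs ujs] gjs ijs mh h0 iq.
have jsS : {subset js <= j :: js} by move=> u ujs'; rewrite in_cons ujs' orbT.
(* [H] collects all factors except that of column j and does not involve the coordinates of this
   column. *)
pose H theta := h theta * \prod_(j <- js) (a j + b j * expR (- Y theta j ^+ 2)).
have H0 theta : 0 <= H theta.
  rewrite mulr_ge0// prodr_ge0// => u _; rewrite addr_ge0// mulr_ge0// expR_ge0//.
have mH : measurable_fun setT H.
  apply: measurable_funM => //; apply: measurable_prod => u _.
  by apply: measurable_funD => //; apply: measurable_funM.
have iH t : ignores (k t j) H.
  move=> theta s; rewrite /H (ijs j (mem_head _ _) t).1; congr (_ * _).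
  apply: eq_big_seq => u ujs'; congr (_ + _ * expR (- _ ^+ 2)).
  apply: eq_bigr => v _; rewrite (ijs j (mem_head _ _) t).2 /update.
  case: eqVneq => // E; have [_ uj] := k_inj (v, u) (t, j) E.
  by rewrite -uj ujs' in jjs.
have step : (\int[mu]_theta (H theta * expR (- Y theta j ^+ 2))%:E =
             \int[mu]_theta (H theta * (Num.sqrt (q theta))^-1)%:E)%E.
  have := @integral_gaussian_linear T (k^~ j) (index_enum T) H (cst 1) (cst 0) B.
  rewrite /=; under eq_integral do rewrite add0r mul1r.
  move=> ->//; last 3 first.
  - rewrite map_inj_uniq; first exact: index_enum_uniq.
    by move=> t u E; have [] := k_inj (t, j) (u, j) E.
  - by move=> t _; apply: gjs; exact: mem_head.
  - by move=> t _; split => //; exact: (ijs j (mem_head _ _) t).2.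
  by apply: eq_integral => theta _; rewrite expr0n/= mulr0 oppr0 expR0 !mulr1.
transitivity (\int[mu]_theta ((a j * H theta)%:E +
    (b j)%:E * (H theta * expR (- Y theta j ^+ 2))%:E))%E.
  apply: eq_integral => theta _; rewrite big_cons -EFinM -EFinD; congr (_%:E).
  by rewrite /H; ring.
have mHE : measurable_fun setT (fun theta => H theta * expR (- Y theta j ^+ 2)).
  exact: measurable_funM.
have mHr : measurable_fun setT (fun theta => H theta * (Num.sqrt (q theta))^-1).
  exact: measurable_funM.
have maH : measurable_fun setT (fun theta => a j * H theta).
  exact: measurable_funM.
rewrite ge0_integralD//; last 4 first.
- by move=> theta _; rewrite lee_fin mulr_ge0.
- exact/measurable_EFinP.
- by move=> theta _; rewrite mule_ge0 ?lee_fin// mulr_ge0 ?expR_ge0.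
- by apply: emeasurable_funM => //; exact/measurable_EFinP.
rewrite ge0_integralZl//; last 3 first.
- exact/measurable_EFinP.
- by move=> theta _; rewrite lee_fin mulr_ge0 ?expR_ge0.
- by rewrite lee_fin.
rewrite step -ge0_integralZl//; last 3 first.
- exact/measurable_EFinP.
- by move=> theta _; rewrite lee_fin mulr_ge0.
- by rewrite lee_fin.
rewrite -ge0_integralD//; last 4 first.
- by move=> theta _; rewrite lee_fin mulr_ge0.
- exact/measurable_EFinP.
- by move=> theta _; rewrite mule_ge0 ?lee_fin// mulr_ge0.
- by apply: emeasurable_funM => //; exact/measurable_EFinP.
(* The factor of column j, now depending on theta through [q] only, joins the weight [h] for the
   induction hypothesis. *)
transitivity (\int[mu]_theta
   ((h theta * (a j + b j * (Num.sqrt (q theta))^-1)) *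
    \prod_(j <- js) (a j + b j * expR (- Y theta j ^+ 2)))%:E)%E.
  apply: eq_integral => theta _; rewrite -EFinM -EFinD; congr (_%:E).
  by rewrite /H; ring.
rewrite IH//.
- by apply: eq_integral => theta _; rewrite big_cons mulrA.
- by move=> u /jsS; exact: gjs.
- move=> u /jsS ujs' t; split; last exact: (ijs u ujs' t).2.
  by move=> theta s; rewrite (ijs u ujs' t).1 iq.
- by apply: measurable_funM => //; apply: measurable_funD => //; apply: measurable_funM.
- by move=> theta; rewrite mulr_ge0// addr_ge0// mulr_ge0.
- by move=> u t /jsS; exact: iq.
Qed.

End gaussian_blocks.

(** * Symmetric laws and the law of the parameters *)

Section sign_flips.
Variables (R : realType) (I : finType).
Variables (mu : probability (coords R I) R) (nu : I -> probability R R).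
Hypothesis mu_nu : product_law mu nu.

Definition flip (s : I -> bool) (theta : coords R I) : coords R I :=
  fun k => (-1) ^+ s k * theta k.

Lemma measurable_flip s : measurable_fun [set: coords R I] (flip s).
Proof.
apply: measurable_fun_coords => k; apply: measurable_funM => //.
exact: measurable_coord.
Qed.

Hypothesis nu_symmetric :
  forall k (A : set R), measurable A -> nu k [set x : R | A (- x)] = nu k A.

(** Each symmetric factor is invariant under a change of sign, and it suffices to compare on
    rectangles. *)
Lemma measure_flip s (A : set (coords R I)) : measurable A ->
  mu (flip s @^-1` A) = mu A.
Proof.
move=> mA; have mf := measurable_flip s.
pose F := @mfun_Sub _ _ (coords R I) (coords R I) _ (mem_set mf).
apply: (@coords_measure_unique _ _ (distribution mu F) mu) => // B mB.
rewrite [RHS]mu_nu//.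
have mB' k : measurable [set x : R | B k ((-1) ^+ s k * x)].
  rewrite -[X in measurable X]setTI.
  have mM : measurable_fun [set: R] (fun x : R => (-1) ^+ s k * x).
    exact: measurable_funM.
  exact: mM.
apply: (eq_trans (mu_nu mB')).
apply: eq_bigr => k _; case: (s k).
  rewrite -[RHS]nu_symmetric//; congr (nu k _).
  by apply/funext => x /=; rewrite expr1 mulN1r.
by congr (nu k _); apply/funext => x /=; rewrite expr0 mul1r.
Qed.

End sign_flips.

Section parameter_law.
Context {dsp : measure_display} {T : measurableType dsp} {R : realType}.
Variables (P : probability T R) (d N L : nat).
Variable Phi : network {RV P >-> R} d N L.

Definition params (w : T) : coords R (param d N L) := fun k => entry Phi k w.

Lemma measurable_params : measurable_fun [set: T] params.
Proof. by apply: measurable_fun_coords => k; exact: measurable_funPT. Qed.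

HB.instance Definition _ :=
  @isMeasurableFun.Build _ _ _ _ params measurable_params.

Hypothesis Phi_random : random_network Phi.

Lemma product_law_params :
  product_law (distribution P params) (fun k => distribution P (entry Phi k)).
Proof.
move=> B mB; have [_ _ indep] := Phi_random.
have := indep [set: _]%SET B mB.
rewrite /distribution /pushforward /=.
have -> : \bigcap_(i in [set` [set: param d N L]%SET]) entry Phi i @^-1` B i =
    params @^-1` rectangle B.
  by apply/seteqP; split=> [w h k|w h k _]; [apply: h; rewrite /= inE|exact: h].
move=> E; apply: (eq_trans E).
by apply: eq_bigl => k; rewrite inE.
Qed.

Lemma gaussian_symmetric (v : R) (X : {RV P >-> R}) : 0 < v ->
  centered_gaussian v X -> forall A : set R, measurable A ->
  distribution P X [set x : R | A (- x)] = distribution P X A.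
Proof.
move=> v0 gX A mA; rewrite !gX//; first by rewrite normal_prob_opp// gt_eqF// sqrtr_gt0.
rewrite -[X in measurable X]setTI.
exact: (@oppr_measurable R setT).
Qed.

Lemma symmetric_params : (0 < N)%N -> symmetric_biases Phi ->
  forall k (A : set R), measurable A ->
    distribution P (entry Phi k) [set x : R | A (- x)] = distribution P (entry Phi k) A.
Proof.
move=> N0 [sb so] k A mA; have [gW gO _] := Phi_random.
have sym (X : {RV P >-> R}) : symmetric_distribution X ->
    distribution P X [set x : R | A (- x)] = distribution P X A.
  by move=> sX; rewrite /distribution /pushforward/=; exact/esym/sX.
case: k => [[[[l [i j]]|[l i]]|j]|[]] /=.
- by apply: (gaussian_symmetric _ (gW l i j)) => //; rewrite divr_gt0// ltr0n.
- exact/sym/sb.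
- exact: (gaussian_symmetric _ (gO j)).
- exact/sym/so.
Qed.

End parameter_law.

(** * Networks with a prescribed activation pattern *)

Section fixed_activation.
Variables (R : realType) (d N L : nat).
Local Notation coords := (coords R (param d N L)).
Implicit Types (theta : coords) (x v : 'cV[R]_d).

Definition weight_of theta (l : 'I_L) : 'M[R]_(N, width d N l) :=
  \matrix_(i, j) theta (inl (inl (inl (existT _ l (i, j))))).

Definition bias_of theta (l : 'I_L) : 'cV[R]_N :=
  \col_i theta (inl (inl (inr (l, i)))).

Definition out_of theta : 'rV[R]_(width d N L) :=
  \row_j theta (inl (inr j)).

Definition net_of theta : network R d N L :=
  Network (weight_of theta) (bias_of theta) (out_of theta) (theta (inr tt)).

Definition pattern := {ffun 'I_L * 'I_N -> bool}.
Implicit Types D : pattern.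

Definition mask D (l : 'I_L) (y : 'cV[R]_N) : 'cV[R]_N :=
  \col_i ((D (l, i))%:R * y i 0).

(* The network obtained from [net_of theta] by replacing every ReLU by the
   multiplication with the prescribed 0-1 pattern D; it is affine in x. *)
Fixpoint lin theta D x (l : nat) : (l <= L)%N -> 'cV[R]_(width d N l) :=
  match l return (l <= L)%N -> 'cV[R]_(width d N l) with
  | 0%N => fun _ => x
  | k.+1 => fun hk : (k < L)%N =>
      mask D (Ordinal hk)
        (weight_of theta (Ordinal hk) *m lin theta D x (ltnW hk)
         + bias_of theta (Ordinal hk))
  end.

Definition preact theta D x l (hl : (l < L)%N) : 'cV[R]_N :=
  weight_of theta (Ordinal hl) *m lin theta D x (ltnW hl)
  + bias_of theta (Ordinal hl).

(** The derivative of [lin] in the direction v: the same recursion without biases. *)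
Fixpoint jac theta D v (l : nat) : (l <= L)%N -> 'cV[R]_(width d N l) :=
  match l return (l <= L)%N -> 'cV[R]_(width d N l) with
  | 0%N => fun _ => v
  | k.+1 => fun hk : (k < L)%N =>
      mask D (Ordinal hk)
        (weight_of theta (Ordinal hk) *m jac theta D v (ltnW hk))
  end.

Definition maskr D (l : 'I_L) (z : 'rV[R]_N) : 'rV[R]_N :=
  \row_i (z 0 i * (D (l, i))%:R).

(** Backpropagation: the row vector is multiplied by the Jacobian from the output side. Started at
    the output weights, it meets each weight matrix only after being built from later layers. *)
Fixpoint pull theta D (l : nat) : (l <= L)%N -> 'rV[R]_(width d N l) -> 'rV[R]_d :=
  match l return (l <= L)%N -> 'rV[R]_(width d N l) -> 'rV[R]_d with
  | 0%N => fun _ z => z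
  | k.+1 => fun (hk : (k < L)%N) (z : 'rV[R]_N) =>
      pull theta D (ltnW hk) (maskr D (Ordinal hk) z *m weight_of theta (Ordinal hk))
  end.

Definition grad theta D : 'rV[R]_d := pull theta D (leqnn L) (out_of theta).

(** Strict in both cases, so that zero has no sign: the condition survives small perturbations and
    determines b. *)
Definition sign_is (b : bool) (a : R) : bool := if b then 0 < a else a < 0.

(** The signs are those of the linear network for D. When t = D the pattern reproduces itself, so D
    is the true activation pattern at x. *)
Definition has_signs theta D x (t : pattern) : Prop :=
  forall l (hl : (l < L)%N) i, sign_is (t (Ordinal hl, i)) (preact theta D x hl i 0).

(** Active preactivations are positive and the others negative, so each ReLU acts as the mask. *)
Lemma hidden_lin theta D x l (hl : (l <= L)%N) : has_signs theta D x D ->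
  hidden (net_of theta) x hl = lin theta D x hl.
Proof.
move=> sD; elim: l hl => //= l IH hl; rewrite IH.
apply/matrixP => i j; rewrite ord1 !mxE.
have := sD l hl i; rewrite /preact !mxE /sign_is; case: (D _) => h /=.
  by rewrite mul1r (max_idPr _)// ltW.
by rewrite mul0r (max_idPl _)// ltW.
Qed.

Lemma lin_step theta D x v (t : R) l (hl : (l <= L)%N) :
  lin theta D (x + t *: v) hl = lin theta D x hl + t *: jac theta D v hl.
Proof.
elim: l hl => //= l IH hl; rewrite IH mulmxDr -scalemxAr.
by apply/matrixP => i j; rewrite !mxE; ring.
Qed.

Lemma preact_step theta D x v (t : R) l (hl : (l < L)%N) :
  preact theta D (x + t *: v) hl = preact theta D x hl +
  t *: (weight_of theta (Ordinal hl) *m jac theta D v (ltnW hl)).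
Proof.
by rewrite /preact lin_step mulmxDr -scalemxAr addrAC.
Qed.

Lemma pull_jac theta D v l (hl : (l <= L)%N) (z : 'rV[R]_(width d N l)) :
  pull theta D hl z *m v = z *m jac theta D v hl.
Proof.
elim: l hl z => //= l IH hl z; rewrite IH -mulmxA.
apply/matrixP => i j; rewrite !mxE; apply: eq_bigr => k _.
by rewrite !ord1 !mxE mulrA.
Qed.

Lemma pull0 theta D l (hl : (l <= L)%N) : pull theta D hl 0 = 0.
Proof.
elim: l hl => //= l IH hl; rewrite -[RHS](IH (ltnW hl)); congr pull.
by apply/matrixP => i j; rewrite !mxE big1// => k _; rewrite !mxE !mul0r.
Qed.

(** Both endpoints have pattern D, so both values come from the same affine function. *)
Lemma net_fun_step theta D x v (t : R) : has_signs theta D x D ->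
  has_signs theta D (x + t *: v) D ->
  net_fun (net_of theta) (x + t *: v) - net_fun (net_of theta) x =
  t * (grad theta D *m v) 0 0.
Proof.
move=> s1 s2; rewrite /net_fun !(hidden_lin _ s1) !(hidden_lin _ s2) /=.
rewrite lin_step mulmxDr -scalemxAr /grad pull_jac !mxE; ring.
Qed.

Lemma small_step (J : finType) (a c : J -> R) : (forall j, a j != 0) ->
  exists2 t : R, 0 < t & forall j, `|t * c j| < `|a j|.
Proof.
(* The summand 1 makes every ratio strictly smaller than [M] and keeps [M] positive when J is
   empty. *)
move=> a0; pose M := 1 + \sum_j `|c j| / `|a j|.
have Mj j : `|c j| / `|a j| < M.
  rewrite /M (bigD1 j)//= [1 + _]addrC -addrA ltrDl ltr_wpDl ?ltr01//.
  by apply: sumr_ge0 => i _; rewrite divr_ge0.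
have M0 : 0 < M by rewrite ltr_pwDl// sumr_ge0// => i _; rewrite divr_ge0.
exists M^-1; first by rewrite invr_gt0.
move=> j; rewrite normrM gtr0_norm ?invr_gt0// mulrC ltr_pdivrMr// mulrC.
by rewrite -ltr_pdivrMr ?normr_gt0.
Qed.

Lemma sign_is_step (b : bool) (a e : R) : sign_is b a -> `|e| < `|a| ->
  sign_is b (a + e).
Proof.
rewrite /sign_is; case: b => a0.
  by rewrite (gtr0_norm a0) ltr_norml => /andP[]; lra.
by rewrite (ltr0_norm a0) ltr_norml => /andP[]; lra.
Qed.

Lemma sign_is_neq0 (b : bool) (a : R) : sign_is b a -> a != 0.
Proof. by rewrite /sign_is; case: b => [/gt_eqF ->|/lt_eqF ->]. Qed.

Lemma has_signs_step theta D x v : has_signs theta D x D ->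
  exists2 t : R, 0 < t & has_signs theta D (x + t *: v) D.
Proof.
move=> sD.
pose a (p : 'I_L * 'I_N) := preact theta D x (ltn_ord p.1) p.2 0.
pose c (p : 'I_L * 'I_N) :=
  (weight_of theta (Ordinal (ltn_ord p.1)) *m
     jac theta D v (ltnW (ltn_ord p.1))) p.2 0.
have [|t t0 ht] := @small_step _ a c.
  by move=> p; exact: sign_is_neq0 (sD _ (ltn_ord p.1) p.2).
exists t => // l hl i; rewrite preact_step.
have E : ltn_ord (Ordinal hl) = hl by exact: bool_irrelevance.
have := ht (Ordinal hl, i); rewrite /a /c /= E => h.
by rewrite mxE [X in _ + X]mxE; apply: sign_is_step.
Qed.

End fixed_activation.

(** * From the gradient of an affine piece to the Lipschitz constant *)

Section lipschitz_lower_bound.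
Variable R : realType.

(** At p = oo the exponent is 0, in agreement with a maximum of equal entries. *)
Lemma pnorm_sign (p : \bar R) (d : nat) (t : R) (v : 'cV[R]_d) : (0 < d)%N ->
  (2%:E <= p)%E -> 0 < t -> (forall j, `|v j 0| = 1) ->
  pnorm p (t *: v) = t * d%:R `^ fine (p^-1)%E.
Proof.
move=> d0 p2 t0 v1.
have tv j : `|(t *: v) j 0| = t by rewrite mxE normrM v1 mulr1 gtr0_norm.
case: p p2 => [r| |]//; rewrite ?lee_fin => r2 /=.
- have r0 : 0 < r by rewrite (lt_le_trans _ r2).
  under eq_bigr do rewrite tv.
  rewrite sumr_const card_ord -[t `^ r *+ d]mulr_natl powRM ?ler0n ?powR_ge0//.
  rewrite -powRrM mulfV ?gt_eqF// powRr1 ?ltW// mulrC.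
  by rewrite inver gt_eqF.
- rewrite powRr0 mulr1.
  under eq_bigr do rewrite tv.
  rewrite big_const_ord; case: d d0 {v v1 tv} => // d _.
  elim: d => [|d IH]; first by rewrite /= (max_idPl _)// ltW.
  by rewrite iterS IH maxxx.
Qed.

Lemma Lip_ge (d N L : nat) (theta : coords R (param d N L)) (D : pattern N L)
    (x : 'cV[R]_d) (c : R) (p : \bar R) : (0 < d)%N ->
  has_signs theta D x D -> (2%:E <= p)%E ->
  c * d%:R <= \sum_j `|grad theta D 0 j| ->
  ((c * d%:R `^ (1 - fine (p^-1)%E))%:E <= Lip p (net_fun (net_of theta)))%E.
Proof.
move=> d0 sD p2 cG.
(* A vanishing component also gets sign 1, so that all entries have modulus 1 and the norm of the
   step is explicit. *)
pose v : 'cV[R]_d := \col_j (if 0 <= grad theta D 0 j then 1 else -1).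
have v1 j : `|v j 0| = 1 by rewrite mxE; case: ifP; rewrite ?normrN normr1.
have Gv : (grad theta D *m v) 0 0 = \sum_j `|grad theta D 0 j|.
  rewrite mxE; apply: eq_bigr => j _; rewrite mxE.
  case: ifPn => [/ger0_norm ->|]; first by rewrite mulr1.
  by rewrite -ltNge => /ltr0_norm ->; rewrite mulrN1.
have [t t0 st] := has_signs_step v sD.
have dp : 0 < d%:R `^ fine (p^-1)%E :> R by rewrite powR_gt0// ltr0n.
apply: (@le_trans _ _
  (`|net_fun (net_of theta) (x + t *: v) - net_fun (net_of theta) x| /
   pnorm p (x + t *: v - x))%:E); last first.
  apply: ereal_sup_ubound; exists (x + t *: v, x) => //=.
  rewrite -subr_eq0 addrAC subrr add0r.
  apply/eqP => /matrixP /(_ (Ordinal d0) 0); rewrite mxE [RHS]mxE => /eqP.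
  by rewrite mulf_eq0 gt_eqF//= -normr_eq0 v1 oner_eq0.
rewrite (net_fun_step sD st) Gv addrAC subrr add0r (pnorm_sign d0 p2 t0 v1).
rewrite lee_fin normrM (gtr0_norm t0) ger0_norm ?sumr_ge0//.
rewrite invfM mulrACA divff ?gt_eqF// mul1r ler_pdivlMr// -mulrA -powRD; last first.
  by rewrite pnatr_eq0 -lt0n d0 implybT.
by rewrite subrK powRr1// ler0n.
Qed.

End lipschitz_lower_bound.

(** * Sign flips *)

Section boolean_measurability.
Context d (T : measurableType d) (R : realType).

Lemma measurable_fun_nat_of_bool (b : T -> bool) : measurable_fun [set: T] b ->
  measurable_fun [set: T] (fun t => (b t)%:R : R).
Proof.
move=> mb.
have -> : (fun t => (b t)%:R) = (fun t => if b t then 1 else 0 : R).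
  by apply/funext => t; case: (b t).
by apply: measurable_fun_ifT => //; exact: measurable_cst.
Qed.

Lemma measurable_forallb (J : finType) (b : J -> T -> bool) :
  (forall j, measurable_fun [set: T] (b j)) ->
  measurable_fun [set: T] (fun t => [forall j, b j t]).
Proof.
move=> mb.
have -> : (fun t => [forall j, b j t]) =
    (fun t => \big[andb/true]_j b j t) by apply/funext => t; rewrite big_andE.
elim: (index_enum J) => [|j s IH].
  by rewrite (_ : (fun t => _) = cst true)//; apply/funext => t; rewrite big_nil.
rewrite (_ : (fun t => _) = (fun t => b j t && \big[andb/true]_(i <- s) b i t)).
  exact: measurable_and.
by apply/funext => t; rewrite big_cons.
Qed.

End boolean_measurability.

Section pattern_flips.
Variables (R : realType) (d N L : nat).
Local Notation coords := (coords R (param d N L)).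
Local Notation pattern := (pattern N L).
Implicit Types (theta : coords) (x v : 'cV[R]_d) (D t : pattern).

Definition widx (l : 'I_L) (i : 'I_N) (j : 'I_(width d N l)) : param d N L :=
  inl (inl (inl (existT _ l (i, j)))).

Lemma weight_ofE theta l i j : weight_of theta l i j = theta (widx i j).
Proof. by rewrite mxE. Qed.

(** Column signs come from the previous layer; the input is never flipped. Since l is a bare natural
    number, as in [lin], [insub] rebuilds the ordinal, and the default [false] concerns only k >=
    L. *)
Definition input_bit t (l : nat) : 'I_(width d N l) -> bool :=
  match l return 'I_(width d N l) -> bool with
  | 0%N => fun _ => false
  | k.+1 => fun j : 'I_N =>
      if @insub _ (fun m => m < L)%N 'I_L k is Some o then ~~ t (o, j) else false
  end.

Arguments input_bit : simpl never.

Lemma input_bitS t k (hk : (k < L)%N) (j : 'I_N) :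
  input_bit t (l := k.+1) j = ~~ t (Ordinal hk, j).
Proof. by rewrite /input_bit insubT. Qed.

(* Row i of layer l is multiplied by (2 D - 1) t, and column j by the sign of
   the j-th preactivation of the previous layer, both signs being read off t. *)
Definition flip_bit D t (k : param d N L) : bool :=
  match k with
  | inl (inl (inl (existT l (i, j)))) => (D (l, i) (+) t (l, i)) (+) input_bit t j
  | inl (inl (inr (l, i))) => D (l, i) (+) t (l, i)
  | inl (inr j) => input_bit t j
  | inr tt => false
  end.

Local Notation flipD D t := (flip (flip_bit D t)).

(** The column signs cancel those carried by the inputs; the row sign, shared with the bias, factors
    out. *)
Lemma preact_flip_of_lin theta D t x l (hl : (l < L)%N) i :
  (forall j, lin (flipD D t theta) D x (ltnW hl) j 0 =
     (-1) ^+ input_bit t j * lin theta D x (ltnW hl) j 0) ->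
  preact (flipD D t theta) D x hl i 0 =
  (-1) ^+ (D (Ordinal hl, i) (+) t (Ordinal hl, i)) * preact theta D x hl i 0.
Proof.
move=> IH; rewrite /preact !mxE mulrDr mulr_sumr; congr (_ + _).
apply: eq_bigr => j _; rewrite IH !weight_ofE /flip /= signr_addb.
set p := (-1) ^+ input_bit t j.
have pp : p * p = 1 by rewrite /p -expr2 sqrr_sign.
by rewrite mulrACA -!mulrA [p * (p * _)]mulrA pp mul1r.
Qed.

(** Where D holds, the row bit is [~~ t], the input bit of the next layer; elsewhere the mask makes
    both sides zero. *)
Lemma lin_flip theta D t x l (hl : (l <= L)%N) j :
  lin (flipD D t theta) D x hl j 0 =
  (-1) ^+ input_bit t j * lin theta D x hl j 0.
Proof.
elim: l hl j => [|l IH] hl j; first by rewrite /= /input_bit expr0 mul1r.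
rewrite (input_bitS t hl) /= !mxE.
have := preact_flip_of_lin j (IH (ltnW hl)); rewrite /preact [LHS]mxE [X in _ * X]mxE.
rewrite [X in X + _]mxE [X in _ + X]mxE => ->.
case: (D _); last by rewrite !mul0r mulr0.
by rewrite !mul1r addTb !mxE.
Qed.

Lemma preact_flip theta D t x l (hl : (l < L)%N) i :
  preact (flipD D t theta) D x hl i 0 =
  (-1) ^+ (D (Ordinal hl, i) (+) t (Ordinal hl, i)) * preact theta D x hl i 0.
Proof. by apply: preact_flip_of_lin => j; exact: lin_flip. Qed.

(** The factor (-1)^(D + t) turns a number of sign t into one of sign D, and conversely. *)
Lemma has_signs_flip theta D t x :
  has_signs (flipD D t theta) D x D <-> has_signs theta D x t.
Proof.
split=> h l hl i; have := h l hl i; rewrite preact_flip /sign_is.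
  by case: (D _); case: (t _); rewrite /= ?expr0 ?expr1 ?mul1r ?mulN1r
    ?oppr_gt0 ?oppr_lt0.
by case: (D _); case: (t _); rewrite /= ?expr0 ?expr1 ?mul1r ?mulN1r
    ?oppr_gt0 ?oppr_lt0.
Qed.

(** At an active neuron the sign of the incoming vector cancels the row sign of the weights, which
    leaves the column signs for the layer below. *)
Lemma pull_flip theta D t l (hl : (l <= L)%N) (z : 'rV[R]_(width d N l)) :
  pull (flipD D t theta) D hl (\row_j (z 0 j * (-1) ^+ input_bit t j)) =
  pull theta D hl z.
Proof.
elim: l hl z => [|l IH] hl z /=.
  by apply/matrixP => i j; rewrite !mxE ord1 /input_bit expr0 mulr1.
rewrite -[RHS]IH; congr pull; apply/matrixP => i j; rewrite !mxE mulr_suml.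
apply: eq_bigr => k _; rewrite !mxE (input_bitS t hl k) /flip /= signr_addb.
case: (D _); last by rewrite !mulr0 !mul0r.
rewrite !mulr1 addTb.
set p := (-1) ^+ (~~ _); have pp : p * p = 1 by rewrite /p -expr2 sqrr_sign.
by rewrite -[RHS]mul1r -pp; ring.
Qed.

Lemma grad_flip theta D t : grad (flipD D t theta) D = grad theta D.
Proof.
rewrite /grad -[RHS](pull_flip _ _ t); congr pull.
by apply/matrixP => i j; rewrite !mxE /flip /= mulrC.
Qed.

(** Induction over the layers: equal activations give equal preactivations, whose signs are the next
    layer of both patterns. *)
Lemma has_signs_pattern_inj theta D D' x :
  has_signs theta D x D -> has_signs theta D' x D' -> D = D'.
Proof.
move=> sD sD'.
have signE (b b' : bool) (a : R) : sign_is b a -> sign_is b' a -> b = b'.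
  by rewrite /sign_is; case: b; case: b' => // a0 /(lt_trans a0); rewrite ltxx.
have linE l (hl : (l <= L)%N) : lin theta D x hl = lin theta D' x hl.
  elim: l hl => //= l IH hl; have E := IH (ltnW hl).
  apply/matrixP => i j; rewrite ord1 !mxE.
  have := sD l hl i; have := sD' l hl i; rewrite /preact E !mxE => s s'.
  by rewrite (signE _ _ _ s' s).
apply/ffunP => -[[l hl] i].
have := sD l hl i; have := sD' l hl i; rewrite /preact linE => s s'.
exact: signE s' s.
Qed.

Lemma has_signs_inj theta D x t t' :
  has_signs theta D x t -> has_signs theta D x t' -> t = t'.
Proof.
move=> s s'; apply/ffunP => -[[l hl] i].
have := s l hl i; have := s' l hl i; rewrite /sign_is.
by case: (t _); case: (t' _) => // a0 /(lt_trans a0); rewrite ltxx.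
Qed.

Lemma ordinal_ltn_ord l (hl : (l < L)%N) : ltn_ord (Ordinal hl) = hl.
Proof. exact: bool_irrelevance. Qed.

Definition preact_ord theta D x (p : 'I_L * 'I_N) : R :=
  preact theta D x (ltn_ord p.1) p.2 0.

Definition has_signsb theta D x t : bool :=
  [forall p, sign_is (t p) (preact_ord theta D x p)].

Lemma has_signsP theta D x t : reflect (has_signs theta D x t) (has_signsb theta D x t).
Proof.
apply: (iffP forallP) => [h l hl i|h [[l hl] i]]; last first.
  by rewrite /preact_ord ordinal_ltn_ord; exact: h.
by have := h (Ordinal hl, i); rewrite /preact_ord ordinal_ltn_ord.
Qed.

Lemma has_signsb_flip theta D t x :
  has_signsb (flipD D t theta) D x D = has_signsb theta D x t.
Proof.
have [h1 h2] := has_signs_flip theta D t x.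
by apply/idP/idP => /has_signsP s; apply/has_signsP; [exact: h1|exact: h2].
Qed.

Lemma sum_has_signsb theta D x :
  \sum_t (has_signsb theta D x t)%:R =
  [forall p, preact_ord theta D x p != 0]%:R :> R.
Proof.
case: forallP => h.
  pose t0 : pattern := [ffun p => 0 < preact_ord theta D x p].
  have s0 : has_signsb theta D x t0.
    apply/forallP => p; rewrite /sign_is ffunE; case: ltrgt0P => // E.
    by have := h p; rewrite E eqxx.
  rewrite (bigD1 t0)//= s0 big1 ?addr0// => t tt0; case: has_signsP => // st.
  by rewrite (has_signs_inj st (has_signsP _ _ _ _ s0)) eqxx in tt0.
rewrite big1// => t _; case: has_signsP => // /has_signsP /forallP st.
by case: h => p; exact: sign_is_neq0 (st p).
Qed.

Lemma measurable_lin D x l (hl : (l <= L)%N) j :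
  measurable_fun [set: coords] (fun theta => lin theta D x hl j 0).
Proof.
elim: l hl j => [|l IH] hl j /=; first exact: measurable_cst.
pose a theta := \sum_k theta (widx (l := Ordinal hl) j k) *
  lin theta D x (ltnW hl) k 0 + theta (inl (inl (inr (Ordinal hl, j)))).
have ma : measurable_fun [set: coords] a.
  apply: measurable_funD; last exact: measurable_coord.
  apply: measurable_sum => k.
  exact: (measurable_funM (measurable_coord _) (IH (ltnW hl) k)).
have := measurable_funM (measurable_cst ((D (Ordinal hl, j))%:R : R)) ma.
congr measurable_fun; apply/funext => theta; rewrite /a !mxE /=.
by congr (_ * (_ + _)); apply: eq_bigr => k _; rewrite ?mxE.
Qed.

Lemma preact_ordE theta D x p : preact_ord theta D x p =
  \sum_k theta (widx (l := p.1) p.2 k) * lin theta D x (ltnW (ltn_ord p.1)) k 0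
   + theta (inl (inl (inr p))).
Proof.
case: p => -[l hl] i; rewrite /preact_ord /preact !ordinal_ltn_ord !mxE /=.
by congr (_ + _); apply: eq_bigr => k _; rewrite ?mxE.
Qed.

Lemma measurable_preact_ord D x p :
  measurable_fun [set: coords] (fun theta => preact_ord theta D x p).
Proof.
pose a theta := \sum_k theta (widx (l := p.1) p.2 k) *
  lin theta D x (ltnW (ltn_ord p.1)) k 0 + theta (inl (inl (inr p))).
have ma : measurable_fun [set: coords] a.
  apply: measurable_funD; last exact: measurable_coord.
  apply: measurable_sum => k.
  exact: (measurable_funM (measurable_coord _) (measurable_lin _ _ _ k)).
by move: ma; congr measurable_fun; apply/funext => theta; rewrite preact_ordE.
Qed.

Lemma measurable_has_signsb D x t :
  measurable_fun [set: coords] (fun theta => has_signsb theta D x t).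
Proof.
apply: measurable_forallb => p; rewrite /sign_is; case: (t p).
  by apply: measurable_fun_ltr => //; exact: measurable_preact_ord.
by apply: measurable_fun_ltr => //; exact: measurable_preact_ord.
Qed.

Lemma measurable_pull D l (hl : (l <= L)%N) (z : coords -> 'rV[R]_(width d N l)) j :
  (forall i, measurable_fun [set: coords] (fun theta => z theta 0 i)) ->
  measurable_fun [set: coords] (fun theta => pull theta D hl (z theta) 0 j).
Proof.
elim: l hl z => [|l IH] hl z mz; first exact: mz.
rewrite /=; apply: (IH (ltnW hl)
  (fun theta => maskr D (Ordinal hl) (z theta) *m weight_of theta (Ordinal hl))) => i.
rewrite (_ : (fun theta => _) = (fun theta => \sum_k
  z theta 0 k * (D (Ordinal hl, k))%:R * theta (widx (l := Ordinal hl) k i))).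
  apply: measurable_sum => k; apply: measurable_funM; last exact: measurable_coord.
  by apply: measurable_funM; [exact: mz|exact: measurable_cst].
by apply/funext => theta; rewrite mxE; apply: eq_bigr => k _; rewrite !mxE.
Qed.

Lemma measurable_grad D j :
  measurable_fun [set: coords] (fun theta => grad theta D 0 j).
Proof.
apply: measurable_pull => i.
rewrite (_ : (fun theta => _) = (fun theta => theta (inl (inr i)))).
  exact: measurable_coord.
by apply/funext => theta; rewrite mxE.
Qed.

End pattern_flips.

(** * The true activation pattern *)

Section expectation.
Context dT (T : measurableType dT) (R : realType) (mu : probability T R).
Implicit Types f g : T -> R.

(** Extended real values spare integrability conditions for nonnegative functions. *)
Definition Ex f : \bar R := (\int[mu]_t (f t)%:E)%E.

Lemma Ex_ge0 f : (forall t, 0 <= f t) -> (0 <= Ex f)%E.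
Proof. by move=> f0; apply: integral_ge0 => t _; rewrite lee_fin. Qed.

Lemma le_Ex f g : measurable_fun setT f -> measurable_fun setT g ->
  (forall t, 0 <= f t) -> (forall t, f t <= g t) -> (Ex f <= Ex g)%E.
Proof.
move=> mf mg f0 fg; apply: ge0_le_integral => //.
- by move=> t _; rewrite lee_fin.
- exact/measurable_EFinP.
- exact/measurable_EFinP.
- by move=> t _; rewrite lee_fin.
Qed.

Lemma Ex_sum (J : finType) (f : J -> T -> R) :
  (forall j, measurable_fun setT (f j)) -> (forall j t, 0 <= f j t) ->
  Ex (fun t => \sum_j f j t) = (\sum_j Ex (f j))%E.
Proof.
move=> mf f0; rewrite /Ex; under eq_integral do rewrite -sumEFin.
by rewrite ge0_integral_sum// => j; [exact/measurable_EFinP|move=> t _; rewrite lee_fin].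
Qed.

Lemma ExD f g : measurable_fun setT f -> measurable_fun setT g ->
  (forall t, 0 <= f t) -> (forall t, 0 <= g t) ->
  Ex (fun t => f t + g t) = (Ex f + Ex g)%E.
Proof.
move=> mf mg f0 g0; rewrite /Ex; under eq_integral do rewrite EFinD.
rewrite ge0_integralD//.
- by move=> t _; rewrite lee_fin.
- exact/measurable_EFinP.
- by move=> t _; rewrite lee_fin.
- exact/measurable_EFinP.
Qed.

Lemma Ex_cst (c : R) : Ex (fun=> c) = c%:E.
Proof.
by rewrite /Ex integral_cst// [X in (_ * X)%E](@probability_setT _ _ _ mu) mule1.
Qed.

Lemma Ex_event (b : T -> bool) : measurable_fun setT b ->
  Ex (fun t => (b t)%:R) = mu [set t | b t].
Proof.
move=> mb; have mB : measurable [set t | b t].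
  by have := mb measurableT [set true]; rewrite setTI; apply.
rewrite /Ex -[in RHS](setIT [set t | b t]) -integral_indic//.
by apply: eq_integral => t _; rewrite indicE; congr ((nat_of_bool _)%:R%:E);
  apply/idP/idP; rewrite inE.
Qed.

End expectation.

Section activation_symmetry.
Variables (R : realType) (d N L : nat).
Local Notation coords := (coords R (param d N L)).
Local Notation pattern := (pattern N L).
Variables (mu : probability coords R) (nu : param d N L -> probability R R).
Hypothesis mu_nu : product_law mu nu.
Hypothesis nu_symmetric :
  forall k (A : set R), measurable A -> nu k [set x : R | A (- x)] = nu k A.
Hypothesis nu_weight_atomless :
  forall l i j (a : R), nu (widx (l := l) i j) [set a] = 0%E.
Implicit Types (theta : coords) (x v : 'cV[R]_d) (D t : pattern).

Lemma Ex_flip s (f : coords -> R) : measurable_fun setT f ->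
  (forall theta, 0 <= f theta) -> Ex mu (fun theta => f (flip s theta)) = Ex mu f.
Proof.
move=> mf f0; have ms := @measurable_flip R (param d N L) s.
pose F := @mfun_Sub _ _ coords coords _ (mem_set ms).
rewrite /Ex [RHS](@eq_measure_integral _ _ _ _ (distribution mu F)); last first.
  by move=> A mA _; apply/esym; exact: (measure_flip mu_nu nu_symmetric).
rewrite ge0_integral_pushforward//; first exact/measurable_EFinP.
by move=> theta _; rewrite lee_fin.
Qed.

Lemma widx_inj (l : 'I_L) (i i' : 'I_N) j j' :
  widx (d := d) (l := l) i j = widx i' j' -> i = i' /\ j = j'.
Proof.
case=> -> E; have : Tagged (fun l : 'I_L => 'I_(width d N l)) j ==
  Tagged (fun l : 'I_L => 'I_(width d N l)) j' by exact/eqP.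
by rewrite eq_Tagged => /eqP.
Qed.

Lemma weight_of_update theta (l l' : 'I_L) i (j : 'I_(width d N l)) s : l' != l ->
  weight_of (update theta (widx i j) s) l' = weight_of theta l'.
Proof.
move=> ll'; apply/matrixP => a b; rewrite !mxE /update.
case: eqVneq => // E.
pose layer (k : param d N L) :=
  if k is inl (inl (inl (existT m _))) then Some m else None.
by have [El] : Some l' = Some l := congr1 layer E; rewrite El eqxx in ll'.
Qed.

Lemma bias_of_update theta (l l' : 'I_L) i (j : 'I_(width d N l)) s :
  bias_of (update theta (widx i j) s) l' = bias_of theta l'.
Proof. by apply/matrixP => a b; rewrite !mxE /update. Qed.

Lemma lin_update theta D x l (hl : (l <= L)%N) (o : 'I_L) i (j : 'I_(width d N o)) s :
  (l <= o)%N -> lin (update theta (widx i j) s) D x hl = lin theta D x hl.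
Proof.
elim: l hl => //= l IH hl lo; rewrite IH; last exact: ltnW.
by rewrite weight_of_update ?bias_of_update// -val_eqE /= ltn_eqF.
Qed.

(** As a function of the weight from input k, the preactivation is affine with slope [lin], which
    depends on earlier layers only. A nonzero slope leaves a single root, a null set for the law of
    the weight. *)
Lemma Ex_preact_eq0 D x (p : 'I_L * 'I_N) (k : 'I_(width d N p.1)) :
  Ex mu (fun theta => ((preact_ord theta D x p == 0) &&
    (lin theta D x (ltnW (ltn_ord p.1)) k 0 != 0))%:R) = 0%E.
Proof.
pose y theta := lin theta D x (ltnW (ltn_ord p.1)) k 0.
rewrite /Ex (integral_resample mu_nu (widx p.2 k)); last 2 first.
- apply/measurable_EFinP/measurable_fun_nat_of_bool/measurable_and.
    by apply: measurable_fun_eqr => //; exact: measurable_preact_ord.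
  apply: measurable_neg; apply: measurable_fun_eqr => //; exact: measurable_lin.
- by move=> theta; rewrite lee_fin.
rewrite -[RHS](integral0 mu setT); apply: eq_integral => theta _.
pose B := \sum_(m | m != k) theta (widx p.2 m) * lin theta D x (ltnW (ltn_ord p.1)) m 0
  + theta (inl (inl (inr p))).
have yE s : lin (update theta (widx p.2 k) s) D x (ltnW (ltn_ord p.1)) =
            lin theta D x (ltnW (ltn_ord p.1)) by exact: lin_update.
have pE s : preact_ord (update theta (widx p.2 k) s) D x p = s * y theta + B.
  rewrite preact_ordE (bigD1 k)//= yE -addrA /update eqxx; congr (_ + (_ + _)).
  apply: eq_bigr => m mk; case: eqVneq => // /widx_inj[_ E].
  by rewrite E eqxx in mk.
under eq_integral do rewrite yE pE.
have [y0|y0] := eqVneq (lin theta D x (ltnW (ltn_ord p.1)) k 0) 0.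
  by under eq_integral do rewrite andbF; rewrite integral0.
transitivity (\int[nu (widx p.2 k)]_s (\1_[set - B / y theta] s)%:E)%E.
  apply: eq_integral => s _; rewrite andbT indicE; congr ((nat_of_bool _)%:R%:E).
  apply/eqP/idP => [|]; rewrite inE /=.
    move=> /eqP E; apply: (mulIf (y0 : y theta != 0)); rewrite divfK//.
    by apply/eqP; rewrite -addr_eq0.
  by move=> ->; rewrite divfK// addNr.
rewrite integral_indic// setIT; exact: nu_weight_atomless.
Qed.

(** After a layer without active neurons the preactivations are just the biases, which may have an
    atom at zero. Such patterns are handled through their zero gradient instead. *)
Definition nondegenerate D := forall l, exists i, D (l, i).

(** Descent: if an active neuron of the previous layer has nonzero output, the current zero is a
    witness; otherwise its own preactivation vanishes. At the bottom, x has a nonzero entry. *)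
Lemma preact_eq0_first theta D x (l : nat) (hl : (l < L)%N) i :
  nondegenerate D -> x != 0 -> preact theta D x hl i 0 = 0 ->
  exists p k, preact_ord theta D x p = 0 /\
    lin theta D x (ltnW (ltn_ord p.1)) k 0 != 0.
Proof.
move=> nD x0; elim: l hl i => [|l IH] hl i a0.
  have [j xj] : exists j, x j 0 != 0.
    apply/existsP; apply: contraNT x0; rewrite negb_exists => /forallP h.
    by apply/eqP/matrixP => j k; rewrite ord1 mxE; apply/eqP/negPn/h.
  exists (Ordinal hl, i), j; split => //.
  by rewrite /preact_ord ordinal_ltn_ord.
have [j Dj] := nD (Ordinal (ltnW hl)).
have [lj|lj] := eqVneq (lin theta D x (ltnW hl) j 0) 0; last first.
  by exists (Ordinal hl, i), j; rewrite /preact_ord !ordinal_ltn_ord.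
apply: (IH (ltnW hl) j); move: lj; rewrite /= mxE.
by rewrite Dj mul1r.
Qed.

Lemma Ex_preact_exists_eq0 D x : nondegenerate D -> x != 0 ->
  Ex mu (fun theta => (~~ [forall p, preact_ord theta D x p != 0])%:R) = 0%E.
Proof.
move=> nD x0; apply/eqP; rewrite eq_le Ex_ge0 ?andbT//.
pose f (q : {p : 'I_L * 'I_N & 'I_(width d N p.1)}) theta : R :=
  ((preact_ord theta D x (tag q) == 0) &&
   (lin theta D x (ltnW (ltn_ord (tag q).1)) (tagged q) 0 != 0))%:R.
have mf q : measurable_fun [set: coords] (f q).
  apply/measurable_fun_nat_of_bool/measurable_and.
    by apply: measurable_fun_eqr => //; exact: measurable_preact_ord.
  by apply: measurable_neg; apply: measurable_fun_eqr => //; exact: measurable_lin.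
have f0 q theta : 0 <= f q theta by [].
apply: (@le_trans _ _ (Ex mu (fun theta => \sum_q f q theta))).
  apply: le_Ex => //.
  - apply/measurable_fun_nat_of_bool/measurable_neg/measurable_forallb => p.
    by apply: measurable_neg; apply: measurable_fun_eqr => //; exact: measurable_preact_ord.
  - exact: measurable_sum.
  - move=> theta; case: forallP => h /=; first exact: sumr_ge0.
    have [[[l hl] i] /negP/negPn/eqP a0] : exists p, ~ (preact_ord theta D x p != 0).
      by apply: contra_notP h => h p; apply: contra_notP h => hp; exists p.
    move: a0; rewrite /preact_ord ordinal_ltn_ord => a0.
    have [p [k [pk0 lk0]]] := preact_eq0_first nD x0 a0.
    rewrite (bigD1 (existT _ p k))//= {1}/f /= pk0 eqxx lk0 /=.
    by rewrite lerDl sumr_ge0.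
rewrite Ex_sum// big1// => -[p k] _; exact: Ex_preact_eq0.
Qed.

Lemma pull_degenerate theta D (l : 'I_L) m (hm : (m <= L)%N) (z : 'rV[R]_(width d N m)) :
  (forall i, D (l, i) = false) -> (l < m)%N -> pull theta D hm z = 0.
Proof.
move=> Dl; elim: m hm z => // m IH hm z; rewrite ltnS leq_eqVlt => /orP[/eqP lm|lm] /=.
  have -> : maskr D (Ordinal hm) z = 0.
    apply/matrixP => i j; rewrite !mxE.
    by have -> : Ordinal hm = l by [apply: val_inj]; rewrite Dl mulr0.
  by rewrite mul0mx pull0.
exact: IH.
Qed.

Lemma grad_degenerate theta D : ~ nondegenerate D -> grad theta D = 0.
Proof.
move=> nD.
have [l hl] : exists l, forall i, D (l, i) = false.
  apply: contra_notP nD => h l; apply: contra_notP h => hl; exists l => i.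
  by apply/negbTE/negP => Di; apply: hl; exists i.
by rewrite /grad (@pull_degenerate theta D l L (leqnn L) _ hl (ltn_ord l)).
Qed.

Variables (x : 'cV[R]_d) (G : 'rV[R]_d -> bool).
Hypotheses (x_neq0 : x != 0) (G0 : G 0 = false).
Hypothesis mG : forall D, measurable_fun [set: coords] (fun theta => G (grad theta D)).

Let g D theta : R := (G (grad theta D))%:R.

Let mg D : measurable_fun [set: coords] (g D).
Proof. exact/measurable_fun_nat_of_bool. Qed.

Let h D t theta : R := (has_signsb theta D x t)%:R.

Let mh D t : measurable_fun [set: coords] (h D t).
Proof. by apply: measurable_fun_nat_of_bool; exact: measurable_has_signsb. Qed.

(** Almost surely exactly one t records the signs, and all sign vectors t contribute the same
    expectation. *)
Lemma Ex_grad_pattern D :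
  ((2 ^ (L * N))%N%:R%:E * Ex mu (fun theta => (h D D theta * g D theta)%R) =
   Ex mu (g D))%E.
Proof.
(* A degenerate pattern has zero gradient, which [G] rejects, so both sides vanish. *)
have [nD|nD] := pselect (nondegenerate D); last first.
  have g0 theta : g D theta = 0 by rewrite /g grad_degenerate// G0.
  have -> : (fun theta => h D D theta * g D theta) = (fun=> 0).
    by apply/funext => theta; rewrite g0 mulr0.
  have -> : g D = (fun=> 0) by apply/funext => theta; exact: g0.
  by rewrite Ex_cst mule0.
pose nz theta : R := [forall p, preact_ord theta D x p != 0]%:R.
have mnz : measurable_fun [set: coords] (fun theta =>
    [forall p, preact_ord theta D x p != 0]).
  apply: measurable_forallb => p.
  by apply: measurable_neg; apply: measurable_fun_eqr => //; exact: measurable_preact_ord.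
pose z theta : R := (~~ [forall p, preact_ord theta D x p != 0])%:R.
have mz : measurable_fun [set: coords] z.
  exact/measurable_fun_nat_of_bool/measurable_neg.
have z0 : Ex mu (fun theta => z theta * g D theta) = 0%E.
  apply/eqP; rewrite eq_le Ex_ge0 ?andbT; last by move=> theta; rewrite mulr_ge0.
  rewrite -(Ex_preact_exists_eq0 nD x_neq0); apply: le_Ex => //.
  - exact: measurable_funM.
  - by move=> theta; rewrite mulr_ge0.
  - by move=> theta; rewrite ler_piMr// /g; case: (G _).
transitivity (Ex mu (fun theta => nz theta * g D theta)); last first.
  rewrite -[LHS]adde0 -z0 -ExD//.
  - congr (Ex mu _); apply/funext => theta; rewrite -mulrDl /nz /z.
    by case: [forall p, _]; rewrite ?addr0 ?add0r mul1r.
  - by apply: measurable_funM => //; exact: measurable_fun_nat_of_bool.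
  - exact: measurable_funM.
  - by move=> theta; rewrite mulr_ge0.
  - by move=> theta; rewrite mulr_ge0.
have -> : (fun theta => nz theta * g D theta) =
    (fun theta => \sum_t h D t theta * g D theta).
  by apply/funext => theta; rewrite -mulr_suml /h sum_has_signsb.
rewrite Ex_sum; last 2 first.
- by move=> t; exact: measurable_funM.
- by move=> t theta; rewrite mulr_ge0.
rewrite (eq_bigr (fun=> Ex mu (fun theta => h D D theta * g D theta))).
  rewrite sumr_const mule_natl; congr (_ *+ _).
  by rewrite card_ffun card_prod !card_ord card_bool.
(* The flip exchanges the sign events for t and for D and fixes the gradient. *)
move=> t _; rewrite -[RHS](Ex_flip (flip_bit D t)).
- by congr (Ex mu _); apply/funext => theta; rewrite /g /h grad_flip has_signsb_flip.
- exact: measurable_funM.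
- by move=> theta; rewrite mulr_ge0.
Qed.

Definition good theta : bool :=
  [exists D, has_signsb theta D x D && G (grad theta D)].

Lemma measurable_good : measurable_fun [set: coords] good.
Proof.
have -> : good = (fun theta =>
    ~~ [forall D, ~~ (has_signsb theta D x D && G (grad theta D))]).
  by apply/funext => theta; rewrite negb_forall; apply: eq_existsb => D; rewrite negbK.
apply: measurable_neg; apply: measurable_forallb => D; apply: measurable_neg.
by apply: measurable_and => //; exact: measurable_has_signsb.
Qed.

(** At most one D reproduces itself at x, so the indicator of [good] is a sum over D. Division by
    the number of patterns turns the right side into an average over a uniform D. *)
Lemma Ex_good :
  ((2 ^ (L * N))%N%:R%:E * Ex mu (fun theta => (good theta)%:R) =
   \sum_D Ex mu (fun theta => (G (grad theta D))%:R))%E.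
Proof.
have -> : (fun theta => (good theta)%:R) =
    (fun theta => \sum_D h D D theta * g D theta).
  apply/funext => theta; rewrite /good; case: existsP => [[D /andP[sD gD]]|nD].
    rewrite (bigD1 D)//= /h /g sD gD mulr1 big1 ?addr0// => D' D'D.
    case: has_signsP => [sD'|]; last by rewrite mul0r.
    by rewrite (has_signs_pattern_inj sD' (has_signsP _ _ _ _ sD)) eqxx in D'D.
  rewrite big1// => D _; apply/eqP; rewrite /h /g -natrM pnatr_eq0 mulnb eqb0.
  by apply/negP => sg; apply: nD; exists D.
rewrite Ex_sum; last 2 first.
- by move=> D; exact: measurable_funM.
- by move=> D theta; rewrite mulr_ge0.
rewrite ge0_sume_distrr; last first.
  by move=> D _; apply: Ex_ge0 => theta; rewrite mulr_ge0.
by apply: eq_bigr => D _; exact: Ex_grad_pattern.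
Qed.

End activation_symmetry.

(** * Tail bounds *)

Section gaussian_tails.
Variables (R : realType) (I : finType).
Variables (mu : probability (coords R I) R) (nu : I -> probability R R).
Hypothesis mu_nu : product_law mu nu.
Variables (sigma : R) (T J : finType) (k : T -> J -> I) (B : T -> coords R I -> R).
Hypotheses (sigma_gt0 : 0 < sigma)
  (k_inj : injective (fun p : T * J => k p.1 p.2))
  (k_gaussian : forall t j, gaussian_coord nu sigma (k t j))
  (B_ignores : forall t j u, ignores (k t j) (B u))
  (mB : forall t, measurable_fun [set: coords R I] (B t)).

Let Y theta j := \sum_t B t theta * theta (k t j).
Let S theta := sigma ^+ 2 * \sum_t B t theta ^+ 2.

Let mY j : measurable_fun [set: coords R I] (fun theta => Y theta j).
Proof.
apply: measurable_sum => t.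
exact: (measurable_funM (mB t) (measurable_coord _)).
Qed.

Let mS : measurable_fun [set: coords R I] S.
Proof.
apply: measurable_funM; first exact: measurable_cst.
by apply: measurable_sum => t; apply: measurable_funX.
Qed.

Let S_ge0 theta : 0 <= S theta.
Proof. by rewrite mulr_ge0 ?sqr_ge0// sumr_ge0// => t _; exact: sqr_ge0. Qed.

Let inv_sqrt_le (a b : R) : 0 < a -> a <= b -> (Num.sqrt b)^-1 <= (Num.sqrt a)^-1.
Proof.
by move=> a0 ab; rewrite lef_pV2 ?posrE ?sqrtr_gt0 ?(lt_le_trans a0 ab)// ler_wsqrtr.
Qed.

(* Chernoff's bound: the indicator is dominated by c times a product of
   functions of the independent column sums Y, whose expectation is explicit. *)
Lemma column_tail (a b : J -> R) (c s : R) (ev : coords R I -> bool) :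
  measurable_fun [set: coords R I] ev ->
  (forall j, 0 <= a j) -> (forall j, 0 <= b j) -> 0 <= c -> 0 <= s ->
  (forall theta, ev theta ->
    1 <= c * \prod_j (a j + b j * expR (- Y theta j ^+ 2))) ->
  (Ex mu (fun theta => (ev theta && (s <= S theta)%R)%:R) <=
   (c * \prod_j (a j + b j * (Num.sqrt (1 + 2 * s))^-1))%:E)%E.
Proof.
move=> mev a0 b0 c0 s0 hev.
pose big theta := (s <= S theta)%R.
pose h theta : R := c * (big theta)%:R.
have mbig : measurable_fun [set: coords R I] big by exact: measurable_fun_ler.
have mh : measurable_fun [set: coords R I] h.
  apply: measurable_funM; first exact: measurable_cst.
  exact: measurable_fun_nat_of_bool.
have h0 theta : 0 <= h theta by rewrite mulr_ge0.
have prod0 theta : 0 <= \prod_j (a j + b j * expR (- Y theta j ^+ 2)).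
  by apply: prodr_ge0 => j _; rewrite addr_ge0// mulr_ge0// expR_ge0.
have prodr0 : 0 <= \prod_j (a j + b j * (Num.sqrt (1 + 2 * s))^-1).
  by apply: prodr_ge0 => j _; rewrite addr_ge0// mulr_ge0// invr_ge0 sqrtr_ge0.
apply: (@le_trans _ _ (Ex mu (fun theta => h theta *
    \prod_(j <- index_enum J) (a j + b j * expR (- Y theta j ^+ 2))))).
  apply: le_Ex.
  - exact/measurable_fun_nat_of_bool/measurable_and.
  - apply: (measurable_funM mh); apply: measurable_prod => j _.
    apply: (measurable_funD (measurable_cst _)).
    apply: (measurable_funM (measurable_cst _)).
    apply: (measurableT_comp (@measurable_expR R)); apply: measurable_funN.
    exact: measurable_funX.
  - by [].
  - move=> theta; rewrite /h /big; case: (s <= S theta); last first.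
      by rewrite andbF mulr0 mul0r.
    rewrite andbT mulr1; case: (boolP (ev theta)) => [/hev//|_].
    by rewrite mulr_ge0.
rewrite /Ex (integral_gaussian_columns (J := J) (k := k) mu_nu sigma_gt0 k_inj
  (index_enum_uniq J) _ _ mh mB h0 a0 b0); last 2 first.
- by move=> j _ t; exact: k_gaussian.
- move=> j _ t; split; last by move=> u; exact: B_ignores.
  move=> theta u; rewrite /h /big /S.
  suff -> : \sum_v B v (update theta (k t j) u) ^+ 2 = \sum_v B v theta ^+ 2 by [].
  by apply: eq_bigr => v _; rewrite B_ignores.
rewrite -(Ex_cst mu); apply: le_Ex.
- apply: (measurable_funM mh); apply: measurable_prod => j _.
  apply: (measurable_funD (measurable_cst _)).
  apply: (measurable_funM (measurable_cst _)).
  apply: measurable_fun_inv.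
    move=> theta; rewrite sqrtr_gt0; apply: ltr_pwDl => //.
    by apply: mulr_ge0 => //; exact: S_ge0.
  apply: measurable_fun_sqrt; apply: (measurable_funD (measurable_cst _)).
  exact: (measurable_funM (measurable_cst _) mS).
- exact: measurable_cst.
- move=> theta; rewrite mulr_ge0// prodr_ge0// => j _.
  by rewrite addr_ge0// mulr_ge0// invr_ge0 sqrtr_ge0.
- move=> theta; rewrite /h /big; case: (lerP s (S theta)) => sS; last first.
    by rewrite mulr0 mul0r mulr_ge0.
  rewrite mulr1 ler_wpM2l//; apply: ler_prod => j _; apply/andP; split.
    by rewrite addr_ge0// mulr_ge0// invr_ge0 sqrtr_ge0.
  rewrite lerD2l ler_wpM2l// inv_sqrt_le//; first by rewrite ltr_pwDl ?mulr_ge0//.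
  by rewrite lerD2l ler_wpM2l.
Qed.

(** Trades the absolute value for a Gaussian exponential, whose mean is known in closed form. *)
Lemma expR_norm_le (t : R) : expR (- `|t|) <= 2^-1 + 2^-1 * expR (- t ^+ 2).
Proof.
rewrite -real_normK ?num_real//; move: (normr_ge0 t); move: `|t| => u u0.
have e1 : 1 + u <= expR u by exact: expR_ge1Dx.
have e2 : expR (- u) <= (1 + u)^-1.
  by rewrite expRN lef_pV2 ?posrE ?expR_gt0//; lra.
apply: (le_trans e2); rewrite -[leLHS]mul1r ler_pdivrMr; last by lra.
(* For u >= 1 the bound 1/(1 + u) <= 1/2 is enough; below 1, (1 + u)(1 - u^2/2) >= 1. *)
have [u1|u1] := lerP 1 u.
  have : 0 <= expR (- u ^+ 2) by exact: expR_ge0.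
  by move: (expR _) => w w0; nra.
have : 1 - u ^+ 2 <= expR (- u ^+ 2) by exact: expR_ge1Dx.
by move: (expR _) => w w0; nra.
Qed.

Lemma l1_tail (tau s : R) : 0 <= s ->
  (Ex mu (fun theta => ((\sum_j `|Y theta j| < tau)%R && (s <= S theta)%R)%:R) <=
   (expR tau * (2^-1 + 2^-1 * (Num.sqrt (1 + 2 * s))^-1) ^+ #|J|)%:E)%E.
Proof.
move=> s0; rewrite -[X in _ ^+ X]/(#|_|) -prodr_const.
have h2 : 0 <= 2^-1 :> R by rewrite invr_ge0.
apply: column_tail => //; last first.
- move=> theta /ltW Yt; rewrite -ler_pdivrMl ?expR_gt0// mulr1 -expRN.
  apply: (@le_trans _ _ (expR (- \sum_j `|Y theta j|))).
    by rewrite ler_expR lerN2.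
  rewrite -sumrN expR_sum; apply: ler_prod => j _.
  by rewrite expR_ge0 expR_norm_le.
- apply: measurable_fun_ltr => //; apply: measurable_sum => j.
  by apply: measurableT_comp.
Qed.

(** Chernoff's bound with parameter 1; other parameters enter through a rescaling of [B]. Masked
    columns contribute a factor 1. *)
Lemma chi_square_tail (D : J -> bool) (tau s : R) : 0 <= s ->
  (Ex mu (fun theta =>
     ((\sum_j (D j)%:R * Y theta j ^+ 2 < tau)%R && (s <= S theta)%R)%:R) <=
   (expR tau * \prod_j (if D j then (Num.sqrt (1 + 2 * s))^-1 else 1))%:E)%E.
Proof.
move=> s0; set r := (Num.sqrt _)^-1.
have -> : \prod_j (if D j then r else 1) = \prod_j ((~~ D j)%:R + (D j)%:R * r).
  by apply: eq_bigr => j _; case: (D j); rewrite ?mul1r ?add0r ?mul0r ?addr0.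
apply: column_tail => //; last first.
- move=> theta /ltW Yt; rewrite -ler_pdivrMl ?expR_gt0// mulr1 -expRN.
  apply: (@le_trans _ _ (expR (- \sum_j (D j)%:R * Y theta j ^+ 2))).
    by rewrite ler_expR lerN2.
  rewrite -sumrN expR_sum; apply: ler_prod => j _; rewrite expR_ge0 /=.
  by case: (D j); rewrite ?mul1r ?add0r ?mul0r ?addr0 ?oppr0 ?expR0.
- apply: measurable_fun_ltr => //; apply: measurable_sum => j.
  by apply: measurable_funM => //; exact: measurable_funX.
Qed.

End gaussian_tails.

(** * Backward propagation of the gradient *)

Section layer_constants.
Variable R : realType.

Lemma inv_sqrt_1D_le (x : R) : 0 <= x ->
  (Num.sqrt (1 + x))^-1 <= 1 - x / 2 + 3 * x ^+ 2 / 8.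
Proof.
move=> x0; set w := 1 - x / 2 + _.
have w0 : 0 < w by rewrite /w; nra.
have sq : 0 < Num.sqrt (1 + x) by rewrite sqrtr_gt0; lra.
rewrite -[leLHS]mul1r ler_pdivrMr// -[leLHS]sqrtr1.
have -> : w * Num.sqrt (1 + x) = Num.sqrt (w ^+ 2 * (1 + x)).
  by rewrite sqrtrM ?sqr_ge0// sqrtr_sqr gtr0_norm.
apply: ler_wsqrtr.
(* The quadratic factor has negative discriminant, hence is positive. *)
have -> : w ^+ 2 * (1 + x) = 1 + x ^+ 3 * (9 / 64 * x ^+ 2 - 15 / 64 * x + 5 / 8).
  by rewrite /w; field.
rewrite lerDl mulr_ge0// ?exprn_ge0//; nra.
Qed.

(** Per neuron the exponent is at most - x eta/4 + 3 x^2/16; x = 2 eta/3 minimises it, with value -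
    eta^2/12. *)
Lemma layer_factor_le (eta : R) (n : nat) : 0 <= eta ->
  let x := 2 * eta / 3 in
  expR (x * (1 - eta) * n%:R / 4) * ((1 + (Num.sqrt (1 + x))^-1) / 2) ^+ n <=
  expR (- (n%:R * eta ^+ 2 / 12)).
Proof.
move=> e0; set x := 2 * eta / 3; have x0 : 0 <= x by rewrite /x; lra.
rewrite /=.
have q0 : 0 <= (1 + (Num.sqrt (1 + x))^-1) / 2.
  by rewrite divr_ge0// addr_ge0// invr_ge0 sqrtr_ge0.
have q1 : (1 + (Num.sqrt (1 + x))^-1) / 2 <= expR (- x / 4 + 3 * x ^+ 2 / 16).
  apply: le_trans (expR_ge1Dx _).
  by have := inv_sqrt_1D_le x0; move: (_^-1) => r; lra.
apply: (@le_trans _ _ (expR (x * (1 - eta) * n%:R / 4) *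
    expR (- x / 4 + 3 * x ^+ 2 / 16) ^+ n)).
  by rewrite ler_wpM2l ?expR_ge0// lerXn2r ?nnegrE ?expR_ge0.
rewrite -expRM_natl -expRD ler_expR /x.
by rewrite le_eqVlt; apply/orP; left; apply/eqP; field.
Qed.

(** Here 1/sqrt(2) <= 3/4, so the base is at most 7/8 <= exp(-1/8), and half of this decay pays for
    exp(n/16). *)
Lemma l1_factor_le (n : nat) :
  expR (n%:R / 16) * (2^-1 + 2^-1 * (Num.sqrt (1 + 2 * 2^-1))^-1) ^+ n <=
  expR (- (n%:R / 16)) :> R.
Proof.
have s2 : (Num.sqrt (1 + 2 * 2^-1))^-1 <= 3 / 4 :> R.
  have h : (4 / 3 : R) <= Num.sqrt (1 + 2 * 2^-1).
    rewrite -[leLHS]gtr0_norm ?divr_gt0// -sqrtr_sqr; apply: ler_wsqrtr; lra.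
  have -> : (3 / 4 : R) = (4 / 3)^-1 by field.
  by rewrite lef_pV2 ?posrE ?divr_gt0// (lt_le_trans _ h)// divr_gt0.
have q0 : 0 <= 2^-1 + 2^-1 * (Num.sqrt (1 + 2 * 2^-1))^-1 :> R.
  by rewrite addr_ge0 ?mulr_ge0 ?invr_ge0// sqrtr_ge0.
have q1 : 2^-1 + 2^-1 * (Num.sqrt (1 + 2 * 2^-1))^-1 <= expR (- (8^-1)) :> R.
  apply: le_trans (expR_ge1Dx _); move: s2; move: (_^-1) => r; lra.
apply: (@le_trans _ _ (expR (n%:R / 16) * expR (- (8^-1)) ^+ n)).
  by rewrite ler_wpM2l ?expR_ge0// lerXn2r ?nnegrE ?expR_ge0.
rewrite -expRM_natl -expRD ler_expR.
by rewrite le_eqVlt; apply/orP; left; apply/eqP; field.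
Qed.

(** The sum factorises over neurons: those of layer l give 1 + r each, all others give 2. *)
Lemma sum_pattern_prod (N L : nat) (l : 'I_L) (r : R) :
  \sum_(D : pattern N L) \prod_(j < N) (if D (l, j) then r else 1) =
  (2 ^ (L * N))%:R * ((1 + r) / 2) ^+ N.
Proof.
pose F (p : 'I_L * 'I_N) (b : bool) : R := if (p.1 == l) && b then r else 1.
have FE (D : pattern N L) : \prod_(j < N) (if D (l, j) then r else 1) =
    \prod_p F p (D p).
  transitivity (\prod_i \prod_j F (i, j) (D (i, j))); last first.
    by rewrite pair_bigA; apply: eq_bigr => -[].
  rewrite (bigD1 l)//= [X in _ = _ * X]big1 ?mulr1; last first.
    by move=> i il; apply: big1 => j _; rewrite /F /= (negbTE il).
  by apply: eq_bigr => j _; rewrite /F /= eqxx.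
under eq_bigr do rewrite FE.
rewrite -(bigA_distr_bigA F).
transitivity (\prod_i \prod_j \sum_b F (i, j) b).
  by rewrite pair_bigA; apply: eq_bigr => -[].
rewrite (bigD1 l)//=.
have -> : \prod_(j < N) \sum_b F (l, j) b = (1 + r) ^+ N.
  transitivity (\prod_(j < N) (1 + r)); last by rewrite prodr_const card_ord.
  by apply: eq_bigr => j _; rewrite big_bool /F /= eqxx addrC.
have -> : \prod_(i < L | i != l) \prod_(j < N) \sum_b F (i, j) b =
    (2 ^+ N) ^+ L.-1 :> R.
  transitivity (\prod_(i in predC1 l) (2 ^+ N) : R); last first.
    by rewrite prodr_const cardC1 card_ord.
  apply: eq_big => [i|i il]; first by rewrite inE.
  transitivity (\prod_(j < N) 2 : R); last by rewrite prodr_const card_ord.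
  by apply: eq_bigr => j _; rewrite big_bool /F /= (negbTE il).
have L0 : (0 < L)%N by exact: leq_ltn_trans (leq0n _) (ltn_ord l).
have N0 : (2 : R) ^+ N != 0 by rewrite expf_neq0.
rewrite natrX mulnC exprM -{2}(prednK L0) exprS expr_div_n.
move: ((2 ^+ N) ^+ L.-1) => c; move: (2 ^+ N) N0 ((1 + r) ^+ N) => a a0 b.
by field.
Qed.

End layer_constants.

(** In the layer induction b says that the norm is still large at the next layer: either it is, or
    it was lost in this step. *)
Lemma Ex_split dT (T : measurableType dT) (R : realType) (mu : probability T R)
    (a b c : T -> bool) : measurable_fun setT a -> measurable_fun setT b ->
  measurable_fun setT c ->
  (Ex mu (fun t => (a t && c t)%:R) <=
   Ex mu (fun t => (a t && b t)%:R) + Ex mu (fun t => (~~ b t && c t)%:R))%E.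
Proof.
move=> ma mb mc; have mbc := measurable_and (measurable_neg mb) mc.
have mab := measurable_and ma mb; have mac := measurable_and ma mc.
rewrite -ExD//; last 2 first.
- exact: measurable_fun_nat_of_bool.
- exact: measurable_fun_nat_of_bool.
apply: le_Ex => //.
- exact: measurable_fun_nat_of_bool.
- by apply: measurable_funD; exact: measurable_fun_nat_of_bool.
- move=> t; rewrite -natrD ler_nat.
  by case: (a t); case: (b t); case: (c t).
Qed.

Section layer_induction.
Variables (R : realType) (d N L : nat).
Local Notation coords := (coords R (param d N L)).
Local Notation pattern := (pattern N L).
Variables (mu : probability coords R) (nu : param d N L -> probability R R).
Hypothesis mu_nu : product_law mu nu.
Hypothesis N_gt0 : (0 < N)%N.
Hypothesis weight_gaussian : forall l i j,
  gaussian_coord nu (Num.sqrt (2 / N%:R)) (widx (l := l) i j).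
Implicit Types (theta : coords) (D : pattern).

Variable eta : R.
Hypotheses (eta_gt0 : 0 < eta) (eta_le1 : eta <= 1).

Definition nsq n (z : 'rV[R]_n) : R := \sum_i z 0 i ^+ 2.

(** [M] is the number of patterns and [delta] the failure probability of one layer; a sum over D is
    [M] times an average. *)
Let M : R := (2 ^ (L * N))%:R.
Let delta : R := expR (- (N%:R * eta ^+ 2 / 12)).
Let x : R := 2 * eta / 3.
Let sig2 : Num.sqrt (2 / N%:R) ^+ 2 = 2 / N%:R :> R.
Proof. by rewrite sqr_sqrtr// divr_ge0. Qed.

Let x_gt0 : 0 < x. Proof. by rewrite /x; have := eta_gt0; lra. Qed.

Let sum_delta (l : 'I_L) (c : R) : c = x * (1 - eta) * N%:R / 4 ->
  (\sum_(D : pattern) (expR c *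
     \prod_(j < N) (if D (l, j) then (Num.sqrt (1 + x))^-1 else 1))%:E
   <= (M * delta)%:E)%E.
Proof.
move=> ->; rewrite sumEFin lee_fin -mulr_sumr sum_pattern_prod mulrCA.
rewrite ler_wpM2l//; exact: (layer_factor_le N (ltW eta_gt0)).
Qed.

Lemma nsq_maskr D l (z : 'rV[R]_N) :
  nsq (maskr D l z) = \sum_j (D (l, j))%:R * z 0 j ^+ 2.
Proof.
apply: eq_bigr => j _; rewrite mxE.
by case: (D _); rewrite ?mulr1 ?mul1r// mulr0 mul0r expr0n.
Qed.

(** The output weights are standard Gaussians and a uniform mask keeps half of them on average,
    whence the reference value N/2. *)
Lemma out_layer (l : 'I_L) (o : coords -> 'rV[R]_N)
    (k : 'I_N -> param d N L) :
  injective k -> (forall j, gaussian_coord nu 1 (k j)) ->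
  (forall theta j, o theta 0 j = theta (k j)) ->
  (\sum_(D : pattern) Ex mu (fun theta =>
     (nsq (maskr D l (o theta)) < (1 - eta) * (N%:R / 2))%R%:R)
   <= (M * delta)%:E)%E.
Proof.
move=> k_inj kg oE; pose lam := x / 2.
have lam0 : 0 < lam by rewrite divr_gt0.
pose c : R := x * (1 - eta) * N%:R / 4.
apply: le_trans (sum_delta l (erefl c)).
apply: lee_sum => D _.
(* With the one-point index set [unit], each column sum is a single output weight scaled by the
   square root of [lam]. *)
have := @chi_square_tail R (param d N L) mu nu mu_nu 1 unit 'I_N (fun _ j => k j)
  (fun _ _ => Num.sqrt lam) ltr01 _ (fun _ j => kg j) _ (fun _ => measurable_cst _)
  (fun j => D (l, j)) c lam (ltW lam0).
have -> : 1 + 2 * lam = 1 + x by rewrite /lam; field.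
move=> H; apply: le_trans (H _ _); last 2 first.
- by move=> [[] i] [[] j] /= /k_inj ->.
- by [].
rewrite le_eqVlt; apply/orP; left; apply/eqP; congr (Ex mu _).
apply/funext => theta; congr ((nat_of_bool _)%:R).
have sum_unit (f : unit -> R) : \sum_t f t = f tt.
  by rewrite (bigD1 tt)//= big1 ?addr0// => -[].
rewrite expr1n mul1r sum_unit sqr_sqrtr ?(ltW lam0)// lexx andbT nsq_maskr.
have -> : \sum_j (D (l, j))%:R * (\sum_(t : unit) Num.sqrt lam * theta (k j)) ^+ 2 =
    lam * \sum_j (D (l, j))%:R * o theta 0 j ^+ 2.
  rewrite mulr_sumr; apply: eq_bigr => j _.
  by rewrite sum_unit exprMn sqr_sqrtr ?ltW// oE; ring.
have -> : c = lam * ((1 - eta) * (N%:R / 2)) by rewrite /c /lam; field.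
by rewrite ltr_pM2l.
Qed.

(** Given z, the entries of the product have variance 2 |z|^2/N and the mask keeps half of them, so
    on average the squared norm is preserved. The argument uses that z does not involve the weights
    of this layer. *)
Lemma middle_layer m (hm : (m.+1 < L)%N) (z : pattern -> coords -> 'rV[R]_N)
    (tau : R) : 0 < tau ->
  (forall D i, measurable_fun [set: coords] (fun theta => z D theta 0 i)) ->
  (forall D i j, ignores (widx (l := Ordinal hm) i j) (z D)) ->
  (\sum_(D : pattern) Ex mu (fun theta =>
     ((nsq (maskr D (Ordinal (ltnW hm)) (z D theta *m weight_of theta (Ordinal hm)))
       < (1 - eta) * tau)%R && (tau <= nsq (z D theta))%R)%:R)
   <= (M * delta)%:E)%E.
Proof.
(* This scaling makes the variance at |z|^2 = tau equal to x/2, the value for which the factor is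
   1/sqrt(1 + x). *)
move=> tau0 mz iz; pose lam := x * N%:R / (4 * tau).
have lam0 : 0 < lam by rewrite divr_gt0// mulr_gt0// ltr0n.
pose c : R := x * (1 - eta) * N%:R / 4.
apply: le_trans (sum_delta (Ordinal (ltnW hm)) (erefl c)).
have sig0 : 0 < Num.sqrt (2 / N%:R) :> R by rewrite sqrtr_gt0 divr_gt0// ltr0n.
have x2 : 0 <= x / 2 by rewrite divr_ge0// ltW.
apply: lee_sum => D _.
have := @chi_square_tail R (param d N L) mu nu mu_nu _ 'I_N 'I_N
  (fun i j => @widx d N L (Ordinal hm) i j)
  (fun i theta => Num.sqrt lam * z D theta 0 i) sig0 _
  (fun i j => @weight_gaussian (Ordinal hm) i j) _ _
  (fun j => D (Ordinal (ltnW hm), j)) c (x / 2) x2.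
have -> : 1 + 2 * (x / 2) = 1 + x by field.
move=> H; apply: le_trans (H _ _ _); last 3 first.
- by move=> [i j] [i' j'] /= /widx_inj[-> ->].
- by move=> i j u theta s; rewrite iz.
- by move=> i; exact: (measurable_funM (measurable_cst _) (mz D i)).
rewrite le_eqVlt; apply/orP; left; apply/eqP; congr (Ex mu _).
apply/funext => theta; congr ((nat_of_bool _)%:R).
have sq t : (Num.sqrt lam * t) ^+ 2 = lam * t ^+ 2 :> R.
  by rewrite exprMn sqr_sqrtr ?ltW.
rewrite nsq_maskr sig2; congr (_ && _).
  have -> : \sum_j (D (Ordinal (ltnW hm), j))%:R *
      (\sum_t Num.sqrt lam * z D theta 0 t *
         theta (@widx d N L (Ordinal hm) t j)) ^+ 2 =
      lam * \sum_j (D (Ordinal (ltnW hm), j))%:R *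
        (z D theta *m weight_of theta (Ordinal hm)) 0 j ^+ 2.
    rewrite mulr_sumr; apply: eq_bigr => j _; rewrite [in RHS]mulrCA -sq.
    congr (_ * _ ^+ 2); rewrite mxE mulr_sumr; apply: eq_bigr => t _.
    by rewrite weight_ofE mulrA.
  have -> : c = lam * ((1 - eta) * tau) by rewrite /c /lam; field; rewrite gt_eqF.
  by rewrite ltr_pM2l.
under eq_bigr do rewrite sq.
rewrite -mulr_sumr -/(nsq _).
have -> : x / 2 = 2 / N%:R * (lam * tau).
  by rewrite /lam; field; rewrite gt_eqF//= pnatr_eq0 -lt0n.
by rewrite ler_pM2l ?divr_gt0 ?ltr0n// ler_pM2l.
Qed.

Lemma measurable_nsq n (z : coords -> 'rV[R]_n) :
  (forall i, measurable_fun [set: coords] (fun theta => z theta 0 i)) ->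
  measurable_fun [set: coords] (fun theta => nsq (z theta)).
Proof. by move=> mz; apply: measurable_sum => i; exact: measurable_funX. Qed.

Lemma measurable_maskr D l (z : coords -> 'rV[R]_N) i :
  (forall i, measurable_fun [set: coords] (fun theta => z theta 0 i)) ->
  measurable_fun [set: coords] (fun theta => maskr D l (z theta) 0 i).
Proof.
move=> mz; have := measurable_funM (mz i) (measurable_cst ((D (l, i))%:R : R)).
by congr measurable_fun; apply/funext => theta; rewrite mxE.
Qed.

Lemma measurable_mul_weight l (z : coords -> 'rV[R]_N) j :
  (forall i, measurable_fun [set: coords] (fun theta => z theta 0 i)) ->
  measurable_fun [set: coords] (fun theta => (z theta *m weight_of theta l) 0 j).
Proof.
move=> mz; pose a theta := \sum_i z theta 0 i * theta (widx (l := l) i j).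
have ma : measurable_fun [set: coords] a.
  by apply: measurable_sum => i; exact: (measurable_funM (mz i) (measurable_coord _)).
move: ma; congr measurable_fun; apply/funext => theta; rewrite mxE.
by apply: eq_bigr => i _; rewrite weight_ofE.
Qed.

Lemma measurable_l1 n (z : coords -> 'rV[R]_n) :
  (forall i, measurable_fun [set: coords] (fun theta => z theta 0 i)) ->
  measurable_fun [set: coords] (fun theta => \sum_i `|z theta 0 i|).
Proof. by move=> mz; apply: measurable_sum => i; apply: measurableT_comp. Qed.

(** Downward induction over the layers: the threshold loses a factor 1 - eta per layer and by
    hypothesis still is at least N/4 at the bottom. Independence is carried by [ignores] for all
    weights not yet met. *)
Lemma pull_layers m (hm : (m < L)%N) (z : pattern -> coords -> 'rV[R]_N) (tau : R) :
  N%:R / 4 <= (1 - eta) ^+ m * tau ->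
  (forall D i, measurable_fun [set: coords] (fun theta => z D theta 0 i)) ->
  (forall D (l : 'I_L) i j, (l <= m)%N -> ignores (widx (l := l) i j) (z D)) ->
  (\sum_(D : pattern) Ex mu (fun theta =>
     ((\sum_j `|@pull R d N L theta D m.+1 hm (z D theta) 0 j| < d%:R / 16)%R &&
      (tau <= nsq (maskr D (Ordinal hm) (z D theta)))%R)%:R)
   <= (M * (expR (- (d%:R / 16)) + m%:R * delta))%:E)%E.
Proof.
have N4 : 0 < N%:R / 4 :> R by rewrite divr_gt0// ltr0n.
have eta1 : 0 <= 1 - eta by rewrite subr_ge0.
elim: m hm z tau => [|m IH] hm z tau htau mz iz.
  rewrite mul0r addr0.
  have Mcard : M = #|pattern|%:R.
    by rewrite /M card_ffun card_prod !card_ord card_bool.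
  have -> : (M * expR (- (d%:R / 16)))%:E =
      (\sum_(D : pattern) (expR (- (d%:R / 16)))%:E)%E.
    by rewrite sumEFin sumr_const Mcard mulr_natl.
  apply: lee_sum => D _.
  pose B (i : 'I_N) theta : R := maskr D (Ordinal hm) (z D theta) 0 i.
  have mB i : measurable_fun [set: coords] (B i) by exact: measurable_maskr.
  have sig0 : 0 < Num.sqrt (2 / N%:R) :> R by rewrite sqrtr_gt0 divr_gt0// ltr0n.
  have h2 : 0 <= 2^-1 :> R by rewrite invr_ge0.
  (* The squared norm is at least N/4, so the d last Gaussians have variance at least (2/N)(N/4) =
     1/2. *)
  have := @l1_tail R (param d N L) mu nu mu_nu _ 'I_N 'I_d
    (fun i j => @widx d N L (Ordinal hm) i j) B sig0 _
    (fun i j => @weight_gaussian (Ordinal hm) i j) _ mB (d%:R / 16) 2^-1 h2.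
  move=> H; apply: le_trans (le_trans (H _ _) _); last 3 first.
  - by move=> [i j] [i' j'] /= /widx_inj[-> ->].
  - by move=> i j u theta s; rewrite /B iz.
  - rewrite lee_fin card_ord; exact: l1_factor_le.
  have YE theta (j : 'I_d) :
      \sum_i B i theta * theta (@widx d N L (Ordinal hm) i j) =
      (maskr D (Ordinal hm) (z D theta) *m weight_of theta (Ordinal hm)) 0 j.
    by rewrite mxE; apply: eq_bigr => i _; rewrite weight_ofE.
  have YS theta : \sum_(j < d) `|\sum_i B i theta *
        theta (@widx d N L (Ordinal hm) i j)| = \sum_(j < d)
      `|(maskr D (Ordinal hm) (z D theta) *m weight_of theta (Ordinal hm)) 0 j|.
    by apply: eq_bigr => j _; rewrite YE.
  have ml1 : measurable_fun [set: coords] (fun theta => \sum_(j < d)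
      `|(maskr D (Ordinal hm) (z D theta) *m weight_of theta (Ordinal hm)) 0 j|).
    apply: (measurable_l1 (z := fun theta => maskr D (Ordinal hm) (z D theta)
      *m weight_of theta (Ordinal hm))) => j.
    by apply: measurable_mul_weight => i; exact: measurable_maskr.
  have mn : measurable_fun [set: coords]
      (fun theta => nsq (maskr D (Ordinal hm) (z D theta))) by exact: measurable_nsq.
  apply: le_Ex => //.
  - apply/measurable_fun_nat_of_bool/measurable_and.
      exact: measurable_fun_ltr.
    exact: measurable_fun_ler.
  - apply/measurable_fun_nat_of_bool/measurable_and.
      apply: measurable_fun_ltr => //; move: ml1; congr measurable_fun.
      by apply/funext => theta; rewrite YS.
    apply: measurable_fun_ler => //; apply: measurable_funM => //.
  - move=> theta; rewrite YS ler_nat.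
    suff leq_b (a b : bool) : (a -> b) -> (a <= b)%N.
      apply: leq_b => /andP[h1 ht].
      apply/andP; split; first exact: h1.
      rewrite sig2 -/(nsq _) mulrAC ler_pdivlMr ?ltr0n//.
      have : N%:R / 4 <= nsq (maskr D (Ordinal hm) (z D theta)).
        by rewrite expr0 mul1r in htau; exact: le_trans ht.
      by rewrite /B /nsq; lra.
    by case: a b => -[]// ab; have := ab isT.
have tau0 : 0 < tau.
  rewrite ltNge; apply/negP => tau0.
  have := mulr_ge0_le0 (exprn_ge0 m.+1 eta1) tau0.
  by rewrite leNgt (lt_le_trans N4 htau).
pose w D theta : 'rV[R]_N := maskr D (Ordinal hm) (z D theta).
pose z' D theta : 'rV[R]_N := w D theta *m weight_of theta (Ordinal hm).
have mw D i : measurable_fun [set: coords] (fun theta => w D theta 0 i).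
  exact: measurable_maskr.
have mz' D i : measurable_fun [set: coords] (fun theta => z' D theta 0 i).
  exact: measurable_mul_weight.
have iz' D (l : 'I_L) i j : (l <= m)%N -> ignores (widx (l := l) i j) (z' D).
  move=> lm theta s; rewrite /z' /w iz; last exact: leqW.
  by rewrite weight_of_update// -val_eqE /= gtn_eqF.
(* The vector moves down one layer with the lowered threshold; [middle_layer] bounds the loss of
   norm in this move. *)
have IH' := IH (ltnW hm) z' ((1 - eta) * tau).
have ML := @middle_layer m hm w tau tau0 mw.
rewrite -[m.+1%:R]natr1 mulrDl mul1r addrA mulrDr EFinD.
apply: le_trans (leeD (IH' _ mz' iz') (ML _)); last 2 first.
- by rewrite mulrA -exprSr.
- by move=> D i j theta s; rewrite /w iz.
rewrite -big_split; apply: lee_sum => D _ /=.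
pose A theta := (\sum_j `|pull theta D (ltnW hm) (z' D theta) 0 j| < d%:R / 16)%R.
pose C theta := ((1 - eta) * tau <= nsq (maskr D (Ordinal (ltnW hm)) (z' D theta)))%R.
pose E theta := (tau <= nsq (w D theta))%R.
have mA : measurable_fun [set: coords] A.
  apply: measurable_fun_ltr => //; apply: measurable_l1 => j.
  exact: measurable_pull.
have mC : measurable_fun [set: coords] C.
  apply: measurable_fun_ler => //; apply: measurable_nsq => j.
  exact: measurable_maskr.
have mE : measurable_fun [set: coords] E.
  by apply: measurable_fun_ler => //; exact: measurable_nsq.
have CE theta : (nsq (maskr D (Ordinal (ltnW hm)) (z' D theta)) <
    (1 - eta) * tau)%R = ~~ C theta by rewrite /C -ltNge.
under [X in (_ <= _ + Ex mu X)%E]eq_fun do rewrite CE.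
exact: (Ex_split mu mA mC mE).
Qed.

End layer_induction.

(** * Failure probability of the whole network and conclusion *)

Lemma grad_l1_average (R : realType) (d N m : nat)
    (mu : probability (coords R (param d N m.+1)) R)
    (nu : param d N m.+1 -> probability R R) (eta : R) :
  product_law mu nu -> (0 < N)%N ->
  (forall l i j, gaussian_coord nu (Num.sqrt (2 / N%:R)) (widx (l := l) i j)) ->
  (forall j, gaussian_coord nu 1 (inl (inr j))) ->
  0 < eta -> eta <= 1 -> 2^-1 <= (1 - eta) ^+ m.+1 ->
  (\sum_(D : pattern N m.+1) Ex mu (fun theta =>
     (\sum_j `|grad theta D 0 j| < d%:R / 16)%R%:R) <=
   ((2 ^ (m.+1 * N))%:R * (expR (- (d%:R / 16)) +
     m.+1%:R * expR (- (N%:R * eta ^+ 2 / 12))))%:E)%E.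
Proof.
move=> mu_nu N0 gW gO e0 e1 he.
pose hm : (m < m.+1)%N := leqnn m.+1; pose tau : R := (1 - eta) * (N%:R / 2).
pose o (theta : coords R (param d N m.+1)) : 'rV[R]_N := out_of theta.
have oE theta j : o theta 0 j = theta (inl (inr j)) by rewrite mxE.
have mo i : measurable_fun [set: coords R (param d N m.+1)] (fun theta => o theta 0 i).
  have := @measurable_coord R (param d N m.+1) (inl (inr i)).
  by congr measurable_fun; apply/funext => theta; rewrite oE.
(* The output mask has already cost one factor 1 - eta; the total is (1 - eta)^L, at least 1/2 by
   assumption. *)
have htau : N%:R / 4 <= (1 - eta) ^+ m * tau.
  rewrite /tau mulrA -exprSr.
  have : 0 <= N%:R :> R by [].
  by move: he; move: ((1 - eta) ^+ m.+1) => y y2 n0; nra.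
have io (D : pattern N m.+1) (l : 'I_m.+1) i j : (l <= m)%N ->
    ignores (widx (l := l) i j) o.
  by move=> _ theta s; apply/matrixP => a b; rewrite !mxE.
have PL := pull_layers mu_nu N0 gW e0 e1 hm htau (fun _ => mo) io.
have k_inj : injective (fun j : 'I_N => inl (inr j) : param d N m.+1).
  by move=> i j [].
have OL := out_layer mu_nu e0 (Ordinal hm) k_inj gO oE.
(* One failure term belongs to the output layer and m to the middle layers. *)
rewrite -[m.+1%:R]natr1 mulrDl mul1r addrA mulrDr EFinD.
apply: le_trans (leeD PL OL); rewrite -big_split; apply: lee_sum => D _ /=.
pose A (theta : coords R (param d N m.+1)) : bool :=
  (\sum_j `|grad theta D 0 j| < d%:R / 16)%R.
pose B (theta : coords R (param d N m.+1)) : bool :=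
  (tau <= nsq (maskr D (Ordinal hm) (o theta)))%R.
have mA : measurable_fun [set: coords R (param d N m.+1)] A.
  apply: measurable_fun_ltr => //; apply: measurable_l1 => j.
  exact: measurable_grad.
have mB : measurable_fun [set: coords R (param d N m.+1)] B.
  apply: measurable_fun_ler => //; apply: measurable_nsq => j.
  exact: measurable_maskr.
have := Ex_split mu mA mB (measurable_cst true).
congr (_ <= _)%E; first by congr (Ex mu _); apply/funext => theta; rewrite andbT.
congr (_ + _)%E.
by congr (Ex mu _); apply/funext => theta; rewrite andbT /B -ltNge.
Qed.

Lemma Bernoulli_inequality (R : realDomainType) (t : R) (n : nat) : 0 <= t -> t <= 1 ->
  1 - n%:R * t <= (1 - t) ^+ n.
Proof.
move=> t0 t1; elim: n => [|n IH]; first by rewrite mul0r subr0 expr0.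
rewrite exprS; apply: (@le_trans _ _ ((1 - t) * (1 - n%:R * t))).
  have : 0 <= n%:R :> R by [].
  by rewrite -natr1; move: n%:R => y y0; nra.
by rewrite ler_wpM2l// subr_ge0.
Qed.

(** With u = N/L^2 the layer term is L exp(-u/48). The assumption on N gives ln L <= u/192 - 1,
    which absorbs the factor L. Both terms are then at most exp(-w/96), and w >= 192 absorbs the
    resulting factor 2. *)
Lemma failure_probability_le (R : realType) (d N L : nat) : (0 < L)%N ->
  192 <= d%:R :> R -> 192 * L%:R ^+ 2 * ln (expR 1 * L%:R) <= N%:R :> R ->
  let eta : R := (2 * L%:R)^-1 in
  expR (- (d%:R / 16)) + L%:R * expR (- (N%:R * eta ^+ 2 / 12)) <=
  expR (- (1 / 192 * Num.min (N%:R / L%:R ^+ 2) d%:R)).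
Proof.
move=> L0 hd hN; have Lr : 0 < L%:R :> R by rewrite ltr0n.
rewrite /=; set u : R := N%:R / L%:R ^+ 2.
have -> : N%:R * (2 * L%:R)^-1 ^+ 2 / 12 = u / 48.
  by rewrite /u; field; rewrite gt_eqF.
have hu : 192 * (1 + ln L%:R) <= u.
  rewrite /u ler_pdivlMr ?exprn_gt0//.
  by move: hN; rewrite lnM ?posrE ?expR_gt0// expRK mulrAC mulrC mulrA.
have lnL : 0 <= ln L%:R :> R by rewrite ln_ge0// ler1n.
set w := Num.min u _.
have wu : w <= u by rewrite /w ge_min lexx.
have wd : w <= d%:R by rewrite /w ge_min lexx orbT.
have w192 : 192 <= w by rewrite /w le_min hd andbT; lra.
have h1 : expR (- (d%:R / 16)) <= expR (- (w / 96)) by rewrite ler_expR; lra.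
have h2 : L%:R * expR (- (u / 48)) <= expR (- (w / 96)).
  by rewrite -{1}(@lnK _ L%:R) ?posrE// -expRD ler_expR; lra.
apply: (le_trans (lerD h1 h2)).
have -> : - (w / 96) = - (1 / 192 * w) + - (w / 192) by field.
rewrite expRD -mulrDr -[leRHS]mulr1 ler_wpM2l ?expR_ge0//.
have : expR (- (w / 192)) <= 2^-1.
  rewrite expRN lef_pV2 ?posrE ?expR_gt0//.
  by apply: le_trans (expR_ge1Dx _); lra.
by move: (expR _) => y; lra.
Qed.

Lemma net_of_params dsp (T : measurableType dsp) (R : realType) (P : probability T R)
    (d N L : nat) (Phi : network {RV P >-> R} d N L) (w : T) :
  net_of (params Phi w) = realization Phi w.
Proof.
rewrite /realization /map_network /net_of /params; congr Network.
- by apply: functional_extensionality_dep => l; apply/matrixP => i j; rewrite !mxE.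
- by apply/funext => l; apply/matrixP => i j; rewrite !mxE ord1.
- by apply/matrixP => i j; rewrite !mxE ord1.
Qed.

Theorem corollary3p7 (R : realType) :
  exists C c : R, 0 < C /\ 0 < c /\
  forall (d N L : nat), (0 < d)%N -> (0 < N)%N -> (0 < L)%N ->
  forall (dsp : measure_display) (T : measurableType dsp) (P : probability T R)
         (Phi : network {RV P >-> R} d N L),
    random_network Phi -> symmetric_biases Phi ->
    C <= d%:R ->
    C * L%:R ^+ 2 * ln (expR 1 * L%:R) <= N%:R ->
    exists E : set T,
      [/\ measurable E,
          ((1 - expR (- (c * Num.min (N%:R / L%:R ^+ 2) d%:R)))%:E <= P E)%E
        & forall w, E w -> forall p : \bar R, (2%:E <= p)%E ->
            ((c * d%:R `^ (1 - fine (p^-1)%E))%:E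
               <= Lip p (net_fun (realization Phi w)))%E].
Proof.
(* The constants come from [failure_probability_le]. *)
exists 192, (1 / 192); split; first by rewrite ltr0n.
split; first by rewrite divr_gt0 ?ltr0n.
move=> d N [//|m] d0 N0 _ dsp T P Phi rPhi sPhi hd hN.
set L := m.+1 in hN *.
have mparams := measurable_params Phi.
pose mu : probability (coords R (param d N L)) R := distribution P (params Phi).
pose nu k : probability R R := distribution P (entry Phi k).
have mu_nu : product_law mu nu by exact: product_law_params.
have nu_sym := symmetric_params rPhi N0 sPhi.
have [gW gO _] := rPhi.
have weight_gaussian l i j : gaussian_coord nu (Num.sqrt (2 / N%:R))
    (widx (d := d) (l := l) i j) by exact: (gW l i j).
have out_gaussian j : gaussian_coord nu 1 (inl (inr j)).
  by move=> A mA; rewrite -[X in normal_prob 0 X]sqrtr1; exact: (gO j).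
have atomless l i j (a : R) : nu (widx (d := d) (l := l) i j) [set a] = 0%E.
  by rewrite weight_gaussian// normal_prob_set1.
(* By Bernoulli's inequality this loss per layer keeps at least half of the squared norm over L
   layers. *)
pose eta : R := (2 * L%:R)^-1.
have Lr : 1 <= L%:R :> R by rewrite ler1n.
have eta0 : 0 < eta by rewrite invr_gt0 mulr_gt0//; lra.
have eta1 : eta <= 1 by rewrite invf_le1 ?mulr_gt0//; lra.
have heta : 2^-1 <= (1 - eta) ^+ L.
  apply: le_trans (Bernoulli_inequality L (ltW eta0) eta1).
  by rewrite /eta invfM mulrCA mulfV ?mulr1; lra.
(* The threshold d/16 is that of [pull_layers]; it exceeds c d, and being positive it rejects the
   zero gradient. *)
pose G (z : 'rV[R]_d) : bool := d%:R / 16 <= \sum_j `|z 0 j|.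
have dr : 0 < d%:R :> R by rewrite ltr0n.
have G0 : G 0 = false.
  rewrite /G; under eq_bigr do rewrite mxE normr0.
  by rewrite big1// leNgt divr_gt0.
have mG (D : pattern N L) : measurable_fun [set: coords R (param d N L)]
    (fun theta => G (grad theta D)).
  apply: measurable_fun_ler => //; apply: measurable_l1 => j.
  exact: measurable_grad.
(* A nonzero input, since at 0 with zero biases every preactivation would vanish. *)
pose x : 'cV[R]_d := const_mx 1.
have x0 : x != 0.
  apply/eqP => /matrixP /(_ (Ordinal d0) 0); rewrite !mxE => /eqP.
  by rewrite oner_eq0.
have mgood := measurable_good x mG.
have mE : measurable ([set theta | good x G theta] : set (coords R (param d N L))).
  by have := mgood measurableT [set true]; rewrite setTI; apply.
exists (params Phi @^-1` [set theta | good x G theta]); split.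
- by rewrite -[X in measurable X]setTI; apply: (mparams measurableT).
- have -> : P (params Phi @^-1` [set theta | good x G theta]) =
      mu [set theta | good x G theta] by [].
  rewrite -(Ex_event mu mgood).
  have := Ex_good mu_nu nu_sym atomless x0 G0 mG.
  have avg := grad_l1_average mu_nu N0 weight_gaussian out_gaussian eta0 eta1 heta.
  have fail := failure_probability_le (ltn0Sn m) hd hN.
  move: avg; set b := (expR _ + _); set M : R := (2 ^ _)%:R => avg gE.
  have b_le : b <= expR (- (1 / 192 * Num.min (N%:R / L%:R ^+ 2) d%:R)) by exact: fail.
  have M0 : 0 < M by rewrite ltr0n expn_gt0.
  have mbad (D : pattern N L) : measurable_fun [set: coords R (param d N L)]
      (fun theta => \sum_j `|grad theta D 0 j| < d%:R / 16).
    apply: measurable_fun_ltr => //; apply: measurable_l1 => j.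
    exact: measurable_grad.
  have tot : (\sum_D Ex mu (fun theta => (G (grad theta D))%:R) +
      \sum_(D : pattern N L) Ex mu (fun theta =>
        (\sum_j `|grad theta D 0 j| < d%:R / 16)%R%:R) = M%:E)%E.
    rewrite -big_split /=.
    transitivity (\sum_(D : pattern N L) (1 : R)%:E)%E.
      apply: eq_bigr => D _; rewrite -ExD//.
      - rewrite -(Ex_cst mu 1); congr (Ex mu _); apply/funext => theta.
        by rewrite /G ltNge; case: (_ <= _); rewrite ?addr0 ?add0r.
      - by apply: measurable_fun_nat_of_bool; exact: mG.
      - by apply: measurable_fun_nat_of_bool; exact: mbad.
    by rewrite sumEFin sumr_const card_ffun card_prod !card_ord card_bool.
  move: tot avg; rewrite -gE.
  have g0 : (0 <= Ex mu (fun theta => (good x G theta)%:R))%E by exact: Ex_ge0.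
  have : (0 <= \sum_(D : pattern N L) Ex mu (fun theta =>
      (\sum_j `|grad theta D 0 j| < d%:R / 16)%R%:R))%E.
    by apply: sume_ge0 => D _; exact: Ex_ge0.
  have g1 : (Ex mu (fun theta => (good x G theta)%:R) <= 1)%E.
    by rewrite Ex_event//; exact: probability_le1.
  move: (Ex mu _) g0 g1 (\sum_D _)%E => g g0 g1 a a0.
  case: g g0 g1 => [g| |]// g0 g1; case: a a0 => [a| |]// a0.
  rewrite -EFinM -EFinD => -[tot]; rewrite !lee_fin => aM.
  (* Here [M * g] is the sum over D of the success probabilities, and the failure probabilities sum
     to at most [M * b]. *)
  have : M * (1 - b) <= M * g by lra.
  by rewrite ler_pM2l//; lra.
- move=> w /existsP[D /andP[/has_signsP sD gD]] p p2.
  rewrite -net_of_params; apply: (Lip_ge d0 sD p2).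
  by apply: le_trans gD; lra.
Qed.
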